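(* Let $\lambda>0$. For all $\mu,\nu\in\mathcal{M}(\Omega;V)$, the problem $$\sup_{\phi\in C(\Omega;V)}\left\{\int_\Omega\langle\phi,\nu-\mu\rangle_V,\ |\nabla\phi|_{V^d,\infty}\le 1,\ |\phi|_{V,\infty}\le\lambda\right\}$$ admits a solution $\phi\in C(\Omega;V)$ with $|\nabla\phi|_{V^d,\infty}\le 1$, and it holds $$\mathcal{T}_{1,1}^\lambda(\mu,\nu)=\max_{\phi\in C(\Omega;V)}\left\{\int_\Omega\langle\phi,\nu-\mu\rangle_V,\ |\nabla\phi|_{V^d,\infty}\le 1,\ |\phi|_{V,\infty}\le\lambda\right\}.$$
   Context: $\Omega\subset\mathbb{R}^d$ is compact and convex with non-empty interior $\mathrm{int}(\Omega)$. $V$ is a real vector space of finite dimension $n$ with scalar product $\langle\cdot,\cdot\rangle_V$ and norm $|\cdot|_V$. $V^d$ carries the scalar product $\langle w,z\rangle_{V^d}=\sum_{l=1}^d\langle w_l,z_l\rangle_V$ and the associated norm $|\cdot|_{V^d}$. $C(\Omega;V)$ is the space of continuous functions, with $|\phi|_{V,\infty}=\sup_{x\in\Omega}|\phi(x)|_V$. $\mathcal{M}(\Omega;V)$ is the space of finite $V$-valued (vector) measures on $\Omega$, the dual of $C(\Omega;V)$ via $(\phi,\mu)\mapsto\int_\Omega\langle\phi,\mu\rangle_V$. For $\delta\in\mathcal{M}(\Omega;V)$, $\int_\Omega|\delta|_V=\sup\{\int_\Omega\langle\varphi,\delta\rangle_V:\varphi\in C(\Omega;V),|\varphi|_{V,\infty}\le1\}$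 is the total variation norm. Gradient and divergence act componentwise in an orthonormal basis of $V$. For $\phi\in C(\Omega;V)$, $$|\nabla\phi|_{V^d,\infty}:=\sup\Big\{\int_\Omega\langle\phi,\operatorname{div}\psi\rangle_V:\ \psi\in C_c^\infty(\mathrm{int}(\Omega);V^d),\ \int_\Omega|\psi|_{V^d}\le1\Big\}\in[0,+\infty],$$ i.e. the $L^\infty$ norm of the distributional gradient ($+\infty$ if it has no $L^\infty$ representative). For $\mu,\nu\in\mathcal{M}(\Omega;V)$, $$W_1^V(\mu,\nu):=\sup_{\phi\in C(\Omega;V)}\Big\{\int_\Omega\langle\phi,\nu-\mu\rangle_V,\ |\nabla\phi|_{V^d,\infty}\le1\Big\}\in[0,+\infty],$$ which is $+\infty$ if $\int_\Omega\mu\ne\int_\Omega\nu$ (as vectors of $V$). Finally, $$\mathcal{T}_{1,1}^\lambda(\mu,\nu):=\inf_{\delta\in\mathcal{M}(\Omega;V)}W_1^V(\mu+\delta,\nu)+\lambda\int_\Omega|\delta|_V.$$ *)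

(* Defs.v *)
From HB Require Import structures.
From mathcomp Require Import all_boot all_order all_algebra.
From mathcomp Require Import ring.
From mathcomp Require Import all_classical all_reals all_analysis.

Set Implicit Arguments.
Unset Strict Implicit.
Unset Printing Implicit Defensive.
Import Order.TTheory GRing.Theory Num.Theory.
Import numFieldNormedType.Exports.
Local Open Scope classical_set_scope.
Local Open Scope measure_display_scope.
Local Open Scope ring_scope.

(* An n-dimensional real inner product space [V], given with an orthonormal
   basis [onb V] in which vector measures are read off. *)
Record euclidean (R : realType) (n : nat) := Euclidean {
  evec :> normedModType R ;
  inner : {dot evec for idfun} ;
  norm_inner : forall v : evec, `|v| = Num.sqrt (inner v v) ;
  onb : 'I_n -> evec ;
  onb_orthonormal : forall i j, inner (onb i) (onb j) = (i == j)%:R ;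
  onb_span : forall v : evec, exists c : 'I_n -> R, v = \sum_i c i *: onb i }.

Section inner_theory.
Context (R : realType) (n : nat) (V : euclidean R n).
Implicit Types u v : V.

Lemma innerC u v : inner V u v = inner V v u.
Proof. by rewrite (hermC (inner V)) /= expr0 mul1r. Qed.

Lemma inner0l v : inner V 0 v = 0. Proof. exact: linear0l. Qed.

Lemma innerDl u w v : inner V (u + w) v = inner V u v + inner V w v.
Proof. exact: linearDl. Qed.

Lemma innerNl u v : inner V (- u) v = - inner V u v.
Proof. exact: linearNl. Qed.

Lemma inner_sqr v : inner V v v = `|v| ^+ 2.
Proof.
rewrite norm_inner sqr_sqrtr//.
have [->|/neq0_dnorm_gt0/ltW//] := eqVneq v 0.
by rewrite inner0l.
Qed.

Lemma inner_polar u v :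
  inner V u v = 4^-1 * (`|u + v| ^+ 2 - `|u - v| ^+ 2).
Proof.
rewrite -!inner_sqr !(innerDl, innerNl) ![inner V _ (_ + _)]innerC.
by rewrite !(innerDl, innerNl) (innerC v u); field.
Qed.

Lemma inner_continuousl v : continuous (fun u => inner V u v).
Proof.
rewrite (_ : (fun u => _) = fun u => 4^-1 * (`|u + v| ^+ 2 - `|u - v| ^+ 2)).
  have sqr_norm w : continuous (fun u : V => `|u + w| ^+ 2).
    move=> u; rewrite /continuous_at !expr2.
    have h : (fun u : V => `|u + w|) @ u --> `|u + w|.
      by apply: cvg_norm; apply: cvgD; [exact: cvg_id|exact: cvg_cst].
    exact: (cvgM h h).
  move=> u; apply: cvgM; first exact: cvg_cst.
  by apply: cvgB; exact: sqr_norm.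
by apply/funext => u; exact: inner_polar.
Qed.

End inner_theory.

(* The library only exposes [m1 \x m2] as a sigma-finite measure when [m1] and
   [m2] are subprobabilities, hence this alias. *)
Definition prod_measure d1 d2 (T1 : measurableType d1) (T2 : measurableType d2)
    (R : realType) (m1 : {sigma_finite_measure set T1 -> \bar R})
    (m2 : {sigma_finite_measure set T2 -> \bar R}) :
  set (T1 * T2) -> \bar R := (m1 \x m2)%E.

Section prod_measure.
Context d1 d2 (T1 : measurableType d1) (T2 : measurableType d2) (R : realType).
Variables (m1 : {sigma_finite_measure set T1 -> \bar R})
          (m2 : {sigma_finite_measure set T2 -> \bar R}).

HB.instance Definition _ := Measure.copy (prod_measure m1 m2) (m1 \x m2)%E.

Let prod_measure_sigma_finite : sigma_finite setT (prod_measure m1 m2).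
Proof.
have /sigma_finiteP[F [TF ndF Foo]] := sigma_finiteT m1.
have /sigma_finiteP[G [TG ndG Goo]] := sigma_finiteT m2.
exists (fun n => F n `*` G n).
  rewrite -setXTT TF TG predeqE => -[x y]; split.
    move=> [/= [n _ Fnx] [k _ Gky]]; exists (maxn n k) => //; split.
    - by move: x Fnx; exact/subsetPset/ndF/leq_maxl.
    - by move: y Gky; exact/subsetPset/ndG/leq_maxr.
  by move=> [n _ []/= ? ?]; split; exists n.
move=> k; have [? ?] := Foo k; have [? ?] := Goo k.
split; first exact: measurableX.
by rewrite /prod_measure product_measure1E// lte_mul_pinfty// ge0_fin_numE.
Qed.

HB.instance Definition _ := Measure_isSigmaFinite.Build _ _ _
  (prod_measure m1 m2) prod_measure_sigma_finite.
End prod_measure.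

Fixpoint Rd_display (R : realType) (d : nat) : measure_display :=
  if d is d'.+1
  then measure_prod_display ((R.-ocitv.-measurable).-sigma, Rd_display R d')
  else default_measure_display.

Fixpoint Rd (R : realType) (d : nat) : measurableType (Rd_display R d) :=
  if d is d'.+1 return measurableType (Rd_display R d)
  then (measurableTypeR R * Rd R d')%type : measurableType _ else unit.

Fixpoint lebesgue_Rd (R : realType) (d : nat) :
    {sigma_finite_measure set (Rd R d) -> \bar R} :=
  if d is d'.+1 return {sigma_finite_measure set (Rd R d) -> \bar R}
  then prod_measure (@lebesgue_measure R) (lebesgue_Rd R d')
  else (\d_tt : {sigma_finite_measure set unit -> \bar R}).

(* [Rd R d] is R * (R * .. unit); [Rd_row] identifies it with the row vectors
   carrying the topology and the derivatives. *)
Fixpoint Rd_row (R : realType) (d : nat) : Rd R d -> 'rV[R]_d :=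
  if d is d'.+1 return Rd R d -> 'rV[R]_d
  then fun p => row_mx (p.1%:M : 'rV[R]_1) (Rd_row p.2) else fun=> 0.

Definition integral_Rd (R : realType) (d : nat) (D : set 'rV[R]_d)
    (f : 'rV[R]_d -> R) : \bar R :=
  (\int[lebesgue_Rd R d]_(y in @Rd_row R d @^-1` D) (f (Rd_row y))%:E)%E.

Definition borel (R : realType) (d : nat) :=
  g_sigma_algebraType (@open 'rV[R]_d).

Section vmeasure.
Context (R : realType) (d n : nat) (V : euclidean R n).

(* V-valued Borel measures on Omega are encoded as Borel measures on R^d
   vanishing outside Omega; values on non-measurable sets are irrelevant. *)
Record vmeasure (Omega : set 'rV[R]_d) := VMeasure {
  vm_fun :> set (borel R d) -> V ;
  vm_sigma_additive : forall F : (set (borel R d))^nat,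
    (forall k, measurable (F k)) -> trivIset setT F ->
    (fun m => \sum_(0 <= k < m) vm_fun (F k)) @ \oo --> vm_fun (\bigcup_k F k) ;
  vm_concentrated : forall A : set (borel R d),
    measurable A -> A `&` Omega = set0 -> vm_fun A = 0 }.

Variable Omega : set 'rV[R]_d.
Implicit Types mu nu delta : vmeasure Omega.

Fact vm_add_sigma_additive mu nu (F : (set (borel R d))^nat) :
  (forall k, measurable (F k)) -> trivIset setT F ->
  (fun m => \sum_(0 <= k < m) (mu (F k) + nu (F k))) @ \oo -->
    mu (\bigcup_k F k) + nu (\bigcup_k F k).
Proof.
move=> mF tF.
rewrite (_ : (fun _ => _) = (fun m => \sum_(0 <= k < m) mu (F k)) \+
  (fun m => \sum_(0 <= k < m) nu (F k))); last first.
  by apply/funext => m /=; rewrite big_split.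
by apply: cvgD; exact: vm_sigma_additive.
Qed.

Fact vm_add_concentrated mu nu (A : set (borel R d)) :
  measurable A -> A `&` Omega = set0 -> mu A + nu A = 0.
Proof. by move=> mA AO; rewrite !vm_concentrated// addr0. Qed.

Definition vm_add mu nu : vmeasure Omega :=
  @VMeasure Omega (fun A => mu A + nu A)
    (@vm_add_sigma_additive mu nu) (@vm_add_concentrated mu nu).

Fact vm_sub_sigma_additive mu nu (F : (set (borel R d))^nat) :
  (forall k, measurable (F k)) -> trivIset setT F ->
  (fun m => \sum_(0 <= k < m) (mu (F k) - nu (F k))) @ \oo -->
    mu (\bigcup_k F k) - nu (\bigcup_k F k).
Proof.
move=> mF tF.
rewrite (_ : (fun _ => _) = (fun m => \sum_(0 <= k < m) mu (F k)) \-
  (fun m => \sum_(0 <= k < m) nu (F k))); last first.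
  by apply/funext => m /=; rewrite sumrB.
by apply: cvgB; exact: vm_sigma_additive.
Qed.

Fact vm_sub_concentrated mu nu (A : set (borel R d)) :
  measurable A -> A `&` Omega = set0 -> mu A - nu A = 0.
Proof. by move=> mA AO; rewrite !vm_concentrated// subr0. Qed.

Definition vm_sub mu nu : vmeasure Omega :=
  @VMeasure Omega (fun A => mu A - nu A)
    (@vm_sub_sigma_additive mu nu) (@vm_sub_concentrated mu nu).

(* The i-th coordinate of [mu] in the orthonormal basis, a signed measure. *)
Definition vm_coord mu (i : 'I_n) (A : set (borel R d)) : \bar R :=
  (inner V (mu A) (onb V i))%:E.

Section vm_coord_charge.
Variables (mu : vmeasure Omega) (i : 'I_n).

Let vm_coord0 : vm_coord mu i set0 = 0.
Proof. by rewrite /vm_coord vm_concentrated ?set0I// inner0l. Qed.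

Let vm_coord_finite A : measurable A -> vm_coord mu i A \is a fin_num.
Proof. by []. Qed.

Let vm_coord_sigma_additive : semi_sigma_additive (vm_coord mu i).
Proof.
move=> F mF tF _; rewrite /vm_coord.
rewrite (_ : (fun _ => _) =
  EFin \o (fun m => inner V (\sum_(0 <= k < m) mu (F k)) (onb V i))).
  apply: cvg_EFin; first exact: nearW.
  apply: (@cvg_comp _ _ _ _ (fun u : V => inner V u (onb V i))).
    exact: vm_sigma_additive.
  exact: inner_continuousl.
by apply/funext => m /=; rewrite sumEFin (big_morph _ (fun u w => innerDl u w _)
  (inner0l _)).
Qed.

HB.instance Definition _ := isCharge.Build _ _ _ (vm_coord mu i)
  vm_coord0 vm_coord_finite vm_coord_sigma_additive.
End vm_coord_charge.

End vmeasure.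

Definition charge_integral d (T : measurableType d) (R : realType)
    (m : {charge set T -> \bar R}) (D : set T) (f : T -> R) : \bar R :=
  let P := cid (Hahn_decomposition m) in
  let N := cid (projT2 P) in
  (\int[jordan_pos (projT2 N)]_(x in D) (f x)%:E -
   \int[jordan_neg (projT2 N)]_(x in D) (f x)%:E)%E.

Section transport.
Context (R : realType) (d n : nat) (V : euclidean R n).
Variable Omega : set 'rV[R]_d.
Implicit Types (phi : 'rV[R]_d -> V) (psi : 'rV[R]_d -> 'I_d -> V).
Implicit Types mu nu delta : vmeasure V Omega.

Definition vm_pairing phi mu : \bar R :=
  (\sum_(i < n) charge_integral (vm_coord mu i) Omega
     (fun x => inner V (phi x) (onb V i)))%E.

Definition sup_norm phi : \bar R := ereal_sup [set `|phi x|%:E | x in Omega].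

Definition vm_norm delta : \bar R :=
  ereal_sup [set vm_pairing phi delta | phi in
    [set phi | {within Omega, continuous phi} /\ (sup_norm phi <= 1)%E]].

Definition inner_pow (w z : 'I_d -> V) : R := \sum_l inner V (w l) (z l).

Definition norm_pow (w : 'I_d -> V) : R := Num.sqrt (inner_pow w w).

(* ['D_v] of a V-valued map; in the basis [onb V] it acts componentwise. *)
Definition partial (l : 'I_d) phi : 'rV[R]_d -> V :=
  fun x => 'D_(delta_mx 0 l) phi x.

(* The iterated partial derivatives of [phi] are all differentiable (hence
   continuous), i.e. [phi] is C^infinity. *)
Definition smooth phi : Prop :=
  forall (s : seq 'I_d) x, differentiable (foldr partial phi s) x.

Definition divergence psi : 'rV[R]_d -> V :=
  fun x => \sum_l partial l (psi^~ l) x.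

Definition field_support psi : set 'rV[R]_d :=
  closure [set x | exists l, psi x l != 0].

Definition test_field psi : Prop :=
  [/\ forall l, smooth (psi^~ l), compact (field_support psi) &
      field_support psi `<=` Omega°].

Definition grad_norm phi : \bar R :=
  ereal_sup [set integral_Rd Omega (fun x => inner V (phi x) (divergence psi x))
    | psi in [set psi | test_field psi /\
        (integral_Rd Omega (fun x => norm_pow (psi x)) <= 1)%E]].

Definition W1 mu nu : \bar R :=
  ereal_sup [set vm_pairing phi (vm_sub nu mu) | phi in
    [set phi | {within Omega, continuous phi} /\ (grad_norm phi <= 1)%E]].

Definition T11 (lambda : R) mu nu : \bar R :=
  ereal_inf [set (W1 (vm_add mu delta) nu + lambda%:E * vm_norm delta)%E |
    delta in [set: vmeasure V Omega]].

Definition dual_admissible (lambda : R) phi : Prop :=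
  [/\ {within Omega, continuous phi}, (grad_norm phi <= 1)%E &
      (sup_norm phi <= lambda%:E)%E].

Definition dual_value (lambda : R) mu nu : \bar R :=
  ereal_sup [set vm_pairing phi (vm_sub nu mu) | phi in dual_admissible lambda].

End transport.

(* Main.v *)
(* Existence: testing the weak gradient bound against a mollified indicator of an
   axis-parallel segment shows that an admissible [phi] is Lipschitz on small
   cubes, hence (convexity) on [Omega], with a constant depending only on [d]; the
   admissible set is then compact for uniform convergence (Arzela-Ascoli), and it
   is closed because the gradient bound is a supremum of continuous linear forms.

   Strong duality needs no Riesz representation, as the infimum over [delta] need
   not be attained.  Replace the constraint [|phi| <= lambda] by the penalty
   [c * sum_k dist(phi(x_k), B_lambda)^2] over a finite net [(x_k)] of [Omega] and
   take a maximizer [phi].  The first-order condition says that the finite sum of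
   Dirac masses [delta = sum_k 2c (phi(x_k) - proj phi(x_k)) d_{x_k}] satisfies
   [W1 (mu + delta) nu + lambda |delta| <= <phi, nu - mu>].  For [c] large and a
   fine net [|phi| <= lambda + tau] on [Omega], so rescaling [phi] by
   [lambda / (lambda + tau)] and letting [tau -> 0] gives the claim. *)
Require Import Defs.
From mathcomp Require Import all_boot all_order all_algebra.
From mathcomp Require Import ring lra.
From mathcomp Require Import all_classical all_reals all_analysis.
From mathcomp Require Import measurable_realfun.
Set Implicit Arguments.
Unset Strict Implicit.
Unset Printing Implicit Defensive.
Import Order.TTheory GRing.Theory Num.Theory.
Import numFieldNormedType.Exports.
Local Open Scope classical_set_scope.
Local Open Scope ring_scope.

(** * Smooth steps *)

(** The gradient bound is known only against compactly supported smooth fields, so these have to be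
    built by hand. Products of one-variable functions are used: iterated partial derivatives, all of
    which [smooth] involves, become one-variable derivatives, and integrals become one-variable
    integrals. The Lipschitz constant [d] obtained in this way need not be sharp: it only provides
    equicontinuity, while the exact bound 1 passes to limits test field by test field. The penalized
    problem keeps the auxiliary constraint |phi| <= lambda + 1. A uniform bound is needed for
    compactness, but the bound lambda would forbid moving towards an arbitrary competitor of [W1],
    whose size is not restricted. Since the maximizer satisfies |phi| <= lambda + tau with tau < 1,
    the auxiliary bound is inactive there, and small convex steps towards any competitor are
    allowed. Only an upper estimate of the squared distance along these steps enters, so the
    projection never has to be differentiated. *)

Section flat_exponential.
Context {R : realType}.

(** Plain existence of [k] successive derivatives, with no continuity asked of the last one; the
    derivative is an explicit witness, so the closure lemmas go by induction on [k]. *)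
Fixpoint Ck (k : nat) (f : R -> R) : Prop :=
  if k is k'.+1 then exists2 f' : R -> R, (forall x : R, is_derive x 1 f (f' x)) & Ck k' f'
  else True.

Lemma CkS k f : Ck k.+1 f -> Ck k f.
Proof.
by elim: k f => // k ih f [f' df Cf']; exists f' => //; exact: ih.
Qed.

Lemma CkD k f g : Ck k f -> Ck k g -> Ck k (fun x => f x + g x).
Proof.
elim: k f g => // k ih f g [f' df Cf'] [g' dg Cg'].
exists (fun x => f' x + g' x); last exact: ih.
by move=> x; exact: is_deriveD.
Qed.

Lemma CkM k f g : Ck k f -> Ck k g -> Ck k (fun x => f x * g x).
Proof.
elim: k f g => // k ih f g Cf Cg.
have [f' df Cf'] := Cf; have [g' dg Cg'] := Cg.
exists (fun x => f x * g' x + g x * f' x).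
  by move=> x; exact: is_deriveM.
by apply: CkD; apply: ih => //; exact: CkS.
Qed.

Lemma Ck_cst k c : Ck k (fun=> c).
Proof.
elim: k c => // k ih c; exists (fun=> 0) => // x; exact: is_derive_cst.
Qed.

(** The derivative of 1/f is -f'/f^2, a product involving 1/f itself, so the induction hypothesis
    applies to it at one order less. *)
Lemma CkV k f : (forall x, f x != 0) -> Ck k f -> Ck k (fun x => (f x)^-1).
Proof.
move=> f0; elim: k => // k ih Cf; have [f' df Cf'] := Cf.
exists (fun x => (- 1) * ((f x)^-1 * (f x)^-1) * f' x).
  move=> x; apply: is_derive_eq (is_deriveV (f0 x) (df x)) _.
  by rewrite /GRing.scale/= mulN1r -exprVn expr2.
apply: (CkM _ Cf'); apply: CkM; first exact: Ck_cst.
by apply: CkM; apply: ih; exact: CkS.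
Qed.

Lemma Ck_comp k f g : Ck k f -> Ck k g -> Ck k (f \o g).
Proof.
elim: k f g => // k ih f g [f' df Cf'] Cg; have [g' dg Cg'] := Cg.
exists (fun x => f' (g x) * g' x); first by move=> x; exact: is_derive1_comp.
by apply: (CkM _ Cg'); apply: ih => //; exact: CkS.
Qed.

Lemma Ck_subl k c : Ck k (fun x => c - x).
Proof.
case: k => // k; exists (fun=> -1); last exact: Ck_cst.
move=> x; apply: is_derive_eq (is_deriveB (is_derive_cst c x 1) (is_derive_id x 1)) _.
by rewrite sub0r.
Qed.

Lemma poly_le_expR (P : {poly R}) :
  exists2 C, 0 < C & forall y, 0 <= y -> `|P.[y]| <= C * expR y.
Proof.
have mono n : exists2 C, 0 <= C & forall y : R, 0 <= y -> y ^+ n <= C * expR y.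
  case: n => [|n].
    exists 1 => // y y0; rewrite expr0 mul1r.
    by rewrite (le_trans _ (expR_ge1Dx y))// lerDl.
  (* exp(y) is the N-th power of exp(y/N), and exp(y/N) >= y/N, with N = [n.+1]. *)
  exists ((n.+1%:R) ^+ n.+1) => [|y y0]; first exact: exprn_ge0.
  have -> : expR y = expR (y / n.+1%:R) ^+ n.+1.
    by rewrite -expRM_natl mulrCA divff ?mulr1// pnatr_eq0.
  rewrite -exprMn lerXn2r ?nnegrE ?mulr_ge0 ?expR_ge0//.
  rewrite -ler_pdivrMl ?ltr0n// mulrC (le_trans _ (expR_ge1Dx _))//.
  by rewrite lerDr.
have /choice[C Cp] : forall n, exists C, 0 <= C /\
    forall y : R, 0 <= y -> y ^+ n <= C * expR y.
  by move=> n; have [C C0 HC] := mono n; exists C.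
exists (1 + \sum_(i < size P) `|P`_i| * C i).
  apply: ltr_wpDr => //; apply: sumr_ge0 => i _.
  by rewrite mulr_ge0//; case: (Cp i).
move=> y y0; rewrite horner_coef mulrDl mul1r mulr_suml.
apply: le_trans (ler_norm_sum _ _ _) _.
apply: ler_wpDl; first exact: expR_ge0.
apply: ler_sum => i _; rewrite normrM -mulrA ler_wpM2l//.
by rewrite ger0_norm ?exprn_ge0//; case: (Cp i) => _; exact.
Qed.

(** The functions P(1/x) exp(-1/x), extended by 0, form a family stable under differentiation: P
    becomes X^2 (P - P'). [P = 1] is the classical flat function. *)
Definition flat_exp (P : {poly R}) (x : R) : R :=
  if 0 < x then P.[x^-1] * expR (- x^-1) else 0.

(** Quadratic decay makes the difference quotient at 0 of order |h|, hence the derivative there 0.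
    It comes from the exponential bound for X^2 P at 1/x. *)
Lemma flat_exp_le (P : {poly R}) :
  exists2 C, 0 < C & forall x, `|flat_exp P x| <= C * `|x| ^+ 2.
Proof.
have [C C0 HC] := poly_le_expR ('X^2 * P); exists C => // x.
rewrite /flat_exp; case: ifPn => [x0|_]; last first.
  by rewrite normr0 mulr_ge0 ?(ltW C0)// exprn_ge0.
have := HC x^-1; rewrite invr_ge0 ltW// => /(_ isT).
rewrite hornerM hornerXn !normrM (gtr0_norm x0) (gtr0_norm (expR_gt0 _)).
rewrite gtr0_norm ?exprn_gt0 ?invr_gt0// expRN ler_pdivrMr ?expR_gt0// => le.
rewrite mulrAC -ler_pdivrMr ?exprn_gt0// (le_trans _ le)//.
by rewrite mulrC expr2 invfM.
Qed.

Lemma is_derive_flat_exp (P : {poly R}) (x : R) :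
  is_derive x 1 (flat_exp P) (flat_exp ('X^2 * (P - P^`())) x).
Proof.
have [x0|x0|->] := ltgtP x 0.
- rewrite {2}/flat_exp ltNge (ltW x0)/=.
  apply: near_eq_is_derive (is_derive_cst 0 x 1).
  near=> y; rewrite /flat_exp ltNge.
  suff /ltW -> : y < 0 by [].
  by near: y; exact: lt_nbhsl.
- have xn0 : x != 0 by rewrite gt_eqF.
  rewrite {2}/flat_exp x0.
  apply: (@near_eq_is_derive R R R (fun y : R => P.[y^-1] * expR (- y^-1))).
    near=> y; rewrite /flat_exp.
    by have -> : 0 < y by near: y; exact: lt_nbhsr.
  have dV : is_derive x 1 (fun y : R => y^-1) (- x ^- 2).
    apply: is_derive_eq; first exact: is_deriveV.
    by rewrite /GRing.scale/= mulr1.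
  have dP := is_derive1_comp (is_derive_poly P x^-1) dV.
  have dE : is_derive x 1 (fun y : R => expR (- y^-1)) (expR (- x^-1) * x ^- 2).
    have := @is_derive1_comp _ expR (- (fun y : R => y^-1)) x _ _
      (is_derive_expR _) (is_deriveN dV).
    by rewrite opprK.
  have := is_deriveM dP dE.
  rewrite -[X in is_derive _ _ X _]/(fun y : R => P.[y^-1] * expR (- y^-1)) => H.
  refine (is_derive_eq H _).
  rewrite hornerM hornerXn hornerD hornerN /GRing.scale/=; field.
  by rewrite xn0.
- rewrite {2}/flat_exp ltxx.
  have [C C0 HC] := flat_exp_le P.
  have lim0 : h^-1 *: ((flat_exp P \o shift 0) (h *: 1) - flat_exp P 0)
      @[h --> (0:R)^'] --> (0:R).
    apply/cvgr0Pnorm_le => e e0.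
    near=> h; rewrite /= addr0 {2}/flat_exp ltxx subr0.
    have h0 : h != 0 by near: h; exact: nbhs_dnbhs_neq.
    rewrite normrM normrV ?unitfE// ler_pdivrMl ?normr_gt0//.
    apply: le_trans (HC _) _; rewrite /GRing.scale/= mulr1 expr2 mulrCA.
    rewrite ler_wpM2l// mulrC -ler_pdivlMr//.
    near: h; apply: dnbhs0_le; exact: divr_gt0.
  by apply: DeriveDef; [apply/cvg_ex; exists 0|exact: cvg_lim].
Unshelve. all: by end_near. Qed.

Lemma Ck_flat_exp k P : Ck k (flat_exp P).
Proof.
elim: k P => // k ih P; exists (flat_exp ('X^2 * (P - P^`()))) => // x.
exact: is_derive_flat_exp.
Qed.

End flat_exponential.

(** * Smooth steps and bumps of width r *)

Section smooth_step.
Context {R : realType}.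

(** The chain of derivatives given by [Ck k] may a priori depend on [k]; uniqueness of derivatives
    identifies all chains with the iterates of [derive1]. *)
Lemma Ck_tower (f : R -> R) : (forall k, Ck k f) -> exists G : nat -> R -> R,
  G 0 = f /\ forall k (x : R), is_derive x 1 (G k) (G k.+1 x).
Proof.
move=> Cf; exists (fun k => iter k (@derive1 R R) f); split=> // k x.
have {Cf} Cf : forall m, Ck m (iter k (@derive1 R R) f).
  elim: k => // k ih m; have [g' dg Cg'] := ih m.+1.
  rewrite iterS (_ : derive1 _ = g')//.
  by apply/funext => y; rewrite derive1E derive_val.
have [g' dg _] := Cf 1%N.
by apply: is_derive_eq (dg x) _; rewrite iterS derive1E derive_val.
Qed.

(** [G 0] is the classical step e(x) / (e(x) + e(r - x)), where e is the flat function, and [G k] is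
    its k-th derivative. [G 1] is then a nonnegative bump of total mass 1 supported in [0, r], the
    mollifier used below. *)
Lemma smooth_step_exists (r : R) : 0 < r -> exists G : nat -> R -> R,
  [/\ forall k (x : R), is_derive x 1 (G k) (G k.+1 x),
      forall x, 0 <= G 0%N x <= 1,
      forall x, x <= 0 -> G 0%N x = 0,
      forall x, r <= x -> G 0%N x = 1 &
      forall x, 0 <= G 1%N x /\ (G 1%N x != 0 -> 0 < x < r)].
Proof.
move=> r0.
pose e : R -> R := flat_exp 1.
pose e' : R -> R := flat_exp ('X^2 * (1 - 1^`())).
have de (x : R) : is_derive x 1 e (e' x) by exact: is_derive_flat_exp.
have eE x : e x = if 0 < x then expR (- x^-1) else 0.
  by rewrite /e /flat_exp hornerC mul1r.
have e'_ge0 x : 0 <= e' x.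
  rewrite /e' /flat_exp; case: ifPn => // x0.
  rewrite hornerM hornerXn -(polyC1 R) derivC subr0 hornerC mulr1.
  by rewrite mulr_ge0 ?expR_ge0// exprn_ge0// invr_ge0 ltW.
have e0 x : x <= 0 -> e x = 0 by move=> x0; rewrite eE ltNge x0.
have e'0 x : x <= 0 -> e' x = 0 by move=> x0; rewrite /e' /flat_exp ltNge x0.
have e_ge0 x : 0 <= e x by rewrite eE; case: ifPn => // _; exact: expR_ge0.
have e_gt0 x : 0 < x -> 0 < e x by rewrite eE => ->; exact: expR_gt0.
pose D x := e x + e (r - x).
have D_gt0 x : 0 < D x.
  have [x0|x0] := ltP 0 x; first by apply: ltr_wpDr => //; exact: e_gt0.
  by apply: ltr_wpDl => //; apply: e_gt0; rewrite subr_gt0 (le_lt_trans x0).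
have D_neq0 x : D x != 0 by rewrite gt_eqF.
have Ce k : Ck k e by exact: Ck_flat_exp.
have CD k : Ck k D by apply: CkD => //; apply: Ck_comp => //; exact: Ck_subl.
have [G [G0 dG]] : exists G : nat -> R -> R, G 0%N = (fun x => e x * (D x)^-1) /\
    forall k (x : R), is_derive x 1 (G k) (G k.+1 x).
  by apply: Ck_tower => k; apply: CkM => //; exact: CkV.
(* In the quotient rule the terms e(x) e'(x) cancel. What remains is a sum of nonnegative products,
   each with a factor vanishing for x <= 0 and one vanishing for x >= r. *)
have G1 x : G 1%N x = (e' x * e (r - x) + e x * e' (r - x)) / (D x) ^+ 2.
  have dr : is_derive x 1 (fun y : R => e (r - y)) (- e' (r - x)).
    have ds : is_derive x 1 (fun y : R => r - y) (- 1).
      apply: is_derive_eq (is_deriveB (is_derive_cst r x 1) (is_derive_id x 1)) _.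
      by rewrite sub0r.
    have := @is_derive1_comp _ e (fun y : R => r - y) _ _ _ (de (r - x)) ds.
    by rewrite mulrN1.
  have dD : is_derive x 1 D (e' x - e' (r - x)) by exact: is_deriveD.
  have dQ := is_deriveM (de x) (is_deriveV (D_neq0 x) dD).
  have := dG 0%N x; rewrite G0 => dG0.
  rewrite -(derive_val (is_derive := dG0)) (derive_val (is_derive := dQ)).
  rewrite /GRing.scale/= /D; field.
  exact: D_neq0.
exists G; split => //.
- move=> x; rewrite G0 divr_ge0 ?(ltW (D_gt0 x))//=.
  by rewrite ler_pdivrMr// mul1r lerDl.
- by move=> x x0; rewrite G0 e0// mul0r.
- by move=> x rx; rewrite G0 /D (e0 (r - x)) ?subr_le0//
    addr0 divff// gt_eqF// e_gt0// (lt_le_trans r0).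
- move=> x; rewrite G1; split.
    by rewrite divr_ge0 ?exprn_ge0 ?(ltW (D_gt0 x))// addr_ge0// mulr_ge0.
  move=> neq0; apply/andP; split; rewrite ltNge; apply: contra neq0 => le0.
    by rewrite (e0 x)// (e'0 x)// !mul0r addr0 mul0r.
  by rewrite (e0 (r - x)) ?(e'0 (r - x)) ?subr_le0// !mulr0 addr0 mul0r.
Qed.

End smooth_step.

(** * Test fields of product form *)

Section product_functions.
Context {R : realType} {d : nat}.
Implicit Types (x : 'rV[R]_d) (l : 'I_d) (a : 'I_d -> nat).

Definition prod_fun (g : 'I_d -> R -> R) x : R := \prod_j g j (x 0 j).

Lemma differentiable_prod_fun (g : 'I_d -> R -> R) x :
  (forall j y, derivable (g j) y 1) -> differentiable (prod_fun g) x.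
Proof.
move=> dg; rewrite /prod_fun; move: (index_enum _) => s.
elim: s => [|j s ih].
  by under eq_fun do rewrite big_nil; exact: differentiable_cst.
under eq_fun do rewrite big_cons.
apply: differentiableM => //.
apply: (@differentiable_comp _ _ _ _ (fun y : 'rV[R]_d => y 0 j : R) (g j)).
  exact: differentiable_coord.
exact/derivable1_diffP/dg.
Qed.

Lemma is_derive_coord l (g : R -> R) x (dg : R) :
  is_derive (x 0 l) 1 g dg ->
  is_derive x (delta_mx 0 l) (fun y : 'rV[R]_d => g (y 0 l)) dg.
Proof.
move=> [dgx dgE].
have E : (fun h : R => h^-1 *: (((fun y : 'rV[R]_d => g (y 0 l)) \o shift x)
    (h *: delta_mx 0 l) - g (x 0 l))) =
  (fun h : R => h^-1 *: ((g \o shift (x 0 l)) (h *: 1) - g (x 0 l))).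
  by apply/funext => h; rewrite /= !mxE !eqxx.
by apply: DeriveDef; rewrite /derivable /derive ?E.
Qed.

Lemma is_derive_constant_along (V : normedModType R) l (f : 'rV[R]_d -> V) x :
  (forall h : R, f (h *: delta_mx 0 l + x) = f x) ->
  is_derive x (delta_mx 0 l) f 0.
Proof.
move=> fE.
have E : (fun h : R => h^-1 *: ((f \o shift x) (h *: delta_mx 0 l) - f x)) =
    fun=> 0.
  by apply/funext => h /=; rewrite fE subrr scaler0.
apply: DeriveDef; rewrite /derivable /derive E; first exact: is_cvg_cst.
by apply/cvg_lim => //; exact: cvg_cst.
Qed.

Lemma is_derive_prod_fun (g : 'I_d -> R -> R) l (g' : R -> R) x :
  (forall y : R, is_derive y 1 (g l) (g' y)) ->
  is_derive x (delta_mx 0 l) (prod_fun g)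
    (prod_fun (fun j => if j == l then g' else g j) x).
Proof.
move=> dg.
pose P x := \prod_(j | j != l) g j (x 0 j).
have dP : is_derive x (delta_mx 0 l) P 0.
  apply: is_derive_constant_along => h; apply: eq_bigr => j jl.
  by rewrite !mxE (negbTE jl) andbF mulr0 add0r.
have := is_deriveM (is_derive_coord (dg (x 0 l))) dP.
rewrite (_ : (_ * _)%R = prod_fun g); last first.
  by apply/funext => y; rewrite /prod_fun (bigD1 l).
rewrite /GRing.scale/= mulr0 add0r => H; apply: is_derive_eq H _.
rewrite /prod_fun (bigD1 l)//= eqxx mulrC; congr (_ * _).
by apply: eq_bigr => j /negbTE ->.
Qed.

Lemma derive_scalel (V : normedModType R) (k : 'rV[R]_d -> R) (v : V) x w :
  derivable k x w -> 'D_w (fun y => k y *: v) x = 'D_w k x *: v.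
Proof.
move=> dk; rewrite {1}/derive.
have E : (fun h : R => h^-1 *: (((fun y => k y *: v) \o shift x) (h *: w) -
    k x *: v)) = fun h => (h^-1 *: ((k \o shift x) (h *: w) - k x)) *: v.
  by apply/funext => h /=; rewrite -scalerBl scalerA.
by rewrite E; apply/cvg_lim => //; exact: cvgZr_tmp.
Qed.

Variables (n : nat) (V : euclidean R n).

(** The multi-index [a] makes the class stable: a partial derivative along [l] raises [a l] by one,
    so iterated partial derivatives are again products of this kind. *)
Lemma smooth_prod_fun (G : 'I_d -> nat -> R -> R) a (v : V) :
  (forall j k (y : R), is_derive y 1 (G j k) (G j k.+1 y)) ->
  smooth (fun x => prod_fun (fun j => G j (a j)) x *: v).
Proof.
move=> dG s x.
have dP b y : differentiable (prod_fun (fun j => G j (b j))) y.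
  by apply: differentiable_prod_fun => j z; exact: ex_derive.
suff [b ->] : exists b, foldr (@partial R d n V)
    (fun x => prod_fun (fun j => G j (a j)) x *: v) s =
    fun x => prod_fun (fun j => G j (b j)) x *: v.
  exact: differentiableZl.
elim: s => [|l s [b ih]]; first by exists a.
exists (fun j => if j == l then (b j).+1 else b j).
rewrite /= ih; apply/funext => y; rewrite /partial derive_scalel.
  rewrite (derive_val (is_derive := is_derive_prod_fun _ (dG l (b l)))).
  by congr (_ *: _); apply: eq_bigr => j _; case: eqP => // ->.
exact: diff_derivable.
Qed.

Lemma smooth0 : smooth (fun _ : 'rV[R]_d => 0 : V).
Proof.
move=> s x; suff -> : foldr (@partial R d n V) (fun=> 0) s = fun=> 0.
  exact: differentiable_cst.
elim: s => //= l s ->; apply/funext => y; exact: derive_cst.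
Qed.

End product_functions.

(** * Lebesgue measure on R^d *)

Section lebesgue_Rd.
Context {R : realType}.

Lemma coord_le_norm d (x : 'rV[R]_d) j : `|x 0 j| <= `|x|.
Proof.
by rewrite [leRHS]/Num.norm/= mx_normrE; apply/bigmax_geP; right; exists (0, j).
Qed.

Lemma rV_norm_lt d (x : 'rV[R]_d) e :
  0 < e -> (forall j, `|x 0 j| < e) -> `|x| < e.
Proof.
move=> e0 xe; rewrite [ltLHS]/Num.norm/= mx_normrE.
by apply/bigmax_ltP; split => // -[i j] _ /=; rewrite ord1.
Qed.

Lemma rV_norm_le d (x : 'rV[R]_d) e :
  0 <= e -> (forall j, `|x 0 j| <= e) -> `|x| <= e.
Proof.
move=> e0 xe; rewrite [leLHS]/Num.norm/= mx_normrE.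
by apply/bigmax_leP; split => // -[i j] _ /=; rewrite ord1.
Qed.

Lemma Rd_row0 d (y : Rd R d.+1) : Rd_row y 0 ord0 = y.1.
Proof.
have <- : (Rd_row y : 'rV_(1 + d)) 0 (lshift d ord0) = y.1 by rewrite /= row_mxEl mxE eqxx.
by congr (Rd_row y 0 _); exact: val_inj.
Qed.

Lemma Rd_rowS d (y : Rd R d.+1) j : Rd_row y 0 (lift ord0 j) = Rd_row y.2 0 j.
Proof.
have <- : (Rd_row y : 'rV_(1 + d)) 0 (rshift 1 j) = Rd_row y.2 0 j by rewrite /= row_mxEr.
by congr (Rd_row y 0 _); exact: val_inj.
Qed.

Lemma measurable_Rd_coord d (j : 'I_d) :
  measurable_fun setT (fun y : Rd R d => Rd_row y 0 j).
Proof.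
elim: d j => [[]//|d ih] j; case: (unliftP ord0 j) => [i|] ->.
  under eq_fun do rewrite Rd_rowS.
  exact: (measurableT_comp (ih i) measurable_snd).
under eq_fun do rewrite Rd_row0.
exact: measurable_fst.
Qed.

Lemma measurable_Rd_ball d (c : 'rV[R]_d) e :
  measurable [set y : Rd R d | `|Rd_row y - c| < e].
Proof.
have [e0|e0] := leP e 0.
  rewrite (_ : mkset _ = set0)// -subset0 => y /=.
  by rewrite ltNge (le_trans e0).
rewrite (_ : mkset _ = \bigcap_(j in [set: 'I_d])
    ((fun y : Rd R d => Rd_row y 0 j) @^-1` `]c 0 j - e, c 0 j + e[)).
  apply: fin_bigcap_measurable => // j _; rewrite -[X in measurable X]setTI.
  exact: measurable_Rd_coord.
apply/seteqP; split => y /=.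
- move=> ye j _ /=; rewrite in_itv/= -ltr_distl.
  by have := le_lt_trans (coord_le_norm _ j) ye; rewrite !mxE.
- move=> ye; apply: rV_norm_lt => // j.
  by have := ye j I; rewrite /= in_itv/= -ltr_distl !mxE.
Qed.

(** Countably many rational cubes fill an open set, the norm on rows being the sup norm. This links
    the Borel sets of rows, generated by the open sets, with the product sigma-algebra of [Rd]. *)
Lemma rational_ball d (U : set 'rV[R]_d) x : open U -> U x ->
  exists (q : 'rV[rat]_d) (m : nat),
    `|x - map_mx ratr q| < m.+1%:R^-1 /\
    forall y, `|y - map_mx ratr q| < m.+1%:R^-1 -> U y.
Proof.
move=> oU Ux; have /nbhs_ballP[e /= e0 eU] := open_nbhs_nbhs (conj oU Ux).
have [m] := @ltr_add_invr R _ _ (divr_gt0 e0 (ltr0Sn _ 1)).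
rewrite add0r => me.
have m0 : 0 < m.+1%:R^-1 :> R by rewrite invr_gt0.
have /choice[q qP] : forall j : 'I_d, exists q : rat,
    ratr q \in `](x 0 j - m.+1%:R^-1), (x 0 j + m.+1%:R^-1)[.
  by move=> j; apply: rat_in_itvoo; rewrite ltrD2l gtrN.
have xq : `|x - map_mx ratr (\row_j q j)| < m.+1%:R^-1.
  by apply: rV_norm_lt => // j; have := qP j; rewrite in_itv/= -ltr_distl !mxE distrC.
exists (\row_j q j), m; split => // y yq.
apply: eU; rewrite mx_norm_ball /ball_/= (splitr e).
rewrite -(subrKA (map_mx ratr (\row_j q j))) (le_lt_trans (ler_normD _ _))//.
by rewrite ltrD ?(lt_trans xq)// distrC (lt_trans yq).
Qed.

Lemma measurable_Rd_row d :
  measurable_fun setT (Rd_row (d := d) : Rd R d -> borel R d).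
Proof.
apply: (@measurability _ _ (Rd R d) (borel R d) setT (@Rd_row R d)
  (@open 'rV[R]_d)) => //.
move=> _ [U oU <-]; rewrite setTI.
rewrite (_ : _ @^-1` _ = \bigcup_(qm in [set qm : 'rV[rat]_d * nat |
    forall y, `|y - map_mx ratr qm.1| < qm.2.+1%:R^-1 -> U y])
    [set y : Rd R d | `|Rd_row y - map_mx ratr qm.1| < qm.2.+1%:R^-1]).
  rewrite bigcup_mkcond; apply: countable_bigcupT_measurable => // qm.
  by case: ifPn => // _; exact: measurable_Rd_ball.
apply/seteqP; split => y /=.
  by move=> /(rational_ball oU)[q [m [? ?]]]; exists (q, m).
by move=> [[q m] /= qU]; exact: qU.
Qed.

Lemma measurable_Rd_box d (M : R) :
  measurable [set y : Rd R d | forall j, `|Rd_row y 0 j| <= M].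
Proof.
rewrite (_ : mkset _ = \bigcap_(j in [set: 'I_d])
    ((fun y : Rd R d => Rd_row y 0 j) @^-1` `[- M, M])).
  apply: fin_bigcap_measurable => // j _; rewrite -[X in measurable X]setTI.
  exact: measurable_Rd_coord.
apply/seteqP; split => y /= yM j; first by rewrite /= in_itv/= -ler_norml.
by have := yM j I; rewrite /= in_itv/= -ler_norml.
Qed.

Lemma lebesgue_Rd_box d (M : R) :
  (lebesgue_Rd R d [set y : Rd R d | forall j, (`|Rd_row y 0%R j| <= M)%R] < +oo)%E.
Proof.
elim: d => [|d ih].
  by rewrite /= diracE; case: (_ \in _); rewrite ltry.
rewrite (_ : mkset _ =
    `[- M, M] `*` [set y : Rd R d | forall j, `|Rd_row y 0 j| <= M]).
  rewrite /= /prod_measure product_measure1E//; last exact: measurable_Rd_box.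
  rewrite lte_mul_pinfty//.
  suff: (@lebesgue_measure R `[- M, M]%classic) \is a fin_num by [].
  by rewrite lebesgue_measure_itv/=; case: ifP.
apply/seteqP; split => y /=.
- move=> yM; split.
    by have := yM ord0; rewrite Rd_row0 in_itv/= -ler_norml.
  by move=> j; rewrite -Rd_rowS.
- rewrite in_itv/= -ler_norml => -[y1 y2] j.
  by case: (unliftP ord0 j) => [i|] ->; rewrite ?Rd_rowS ?Rd_row0.
Qed.

(** Induction on the dimension by Tonelli, which is why the factors are nonnegative. *)
Lemma integral_Rd_prod_fun d (g : 'I_d -> R -> R) (c : 'I_d -> R) :
  (forall j, measurable_fun setT (g j)) -> (forall j s, 0 <= g j s) ->
  (forall j, \int[lebesgue_measure]_s (g j s)%:E = (c j)%:E)%E ->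
  (\int[lebesgue_Rd R d]_y (prod_fun g (Rd_row y))%:E = (\prod_j c j)%:E)%E.
Proof.
elim: d g c => [|d ih] g c mg g0 gc.
  rewrite /= integral_dirac//.
  rewrite diracE in_setT mul1e.
  by rewrite /prod_fun !big_ord0.
have gE (y : Rd R d.+1) : prod_fun g (Rd_row y) =
    g ord0 y.1 * prod_fun (fun j => g (lift ord0 j)) (Rd_row y.2).
  rewrite /prod_fun big_ord_recl Rd_row0; congr (_ * _).
  by apply: eq_bigr => j _; rewrite Rd_rowS.
have mprod k (h : 'I_k -> R -> R) : (forall j, measurable_fun setT (h j)) ->
    measurable_fun setT (fun y : Rd R k => prod_fun h (Rd_row y)).
  move=> mh; apply: measurable_prod => j _.
  exact: (measurableT_comp (mh j) (measurable_Rd_coord j)).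
have prod0 k (h : 'I_k -> R -> R) y : (forall j s, 0 <= h j s) ->
    0 <= prod_fun h y.
  by move=> h0; apply: prodr_ge0 => j _.
have inner x : (\int[lebesgue_Rd R d]_y
    (prod_fun g (Rd_row ((x, y) : Rd R d.+1)))%:E =
    (\prod_(j < d) c (lift ord0 j))%:E * (g ord0 x)%:E)%E.
  rewrite muleC -(ih (fun j => g (lift ord0 j)) (fun j => c (lift ord0 j)))//.
  rewrite -(@ge0_integralZl _ _ R (lebesgue_Rd R d) setT measurableT
    (fun y => (prod_fun (fun j => g (lift ord0 j)) (Rd_row y))%:E)) => //.
  - by apply: eq_integral => y _; rewrite gE EFinM.
  - by apply/measurable_EFinP; exact: (mprod d).
  - by move=> y _; rewrite lee_fin prod0.
  - by rewrite lee_fin.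
have /= := @fubini_tonelli1 _ _ _ _ R (@lebesgue_measure R) (lebesgue_Rd R d)
  (fun y => (prod_fun g (Rd_row (y : Rd R d.+1)))%:E).
rewrite /prod_measure => -> //; last 2 first.
  by apply/measurable_EFinP; exact: (mprod d.+1 g).
  by move=> y; rewrite lee_fin prod0.
rewrite /fubini_F big_ord_recl EFinM -gc.
under eq_integral => x _ do rewrite inner.
rewrite ge0_integralZl//.
- by rewrite muleC.
- by apply/measurable_EFinP; exact: mg.
- by move=> x _; rewrite lee_fin.
- rewrite lee_fin; apply: prodr_ge0 => j _.
  rewrite -lee_fin -gc; apply: integral_ge0 => s _.
  by rewrite lee_fin.
Qed.

End lebesgue_Rd.

(** * Euclidean spaces and integration on a compact set *)

Section euclidean_theory.
Context {R : realType} {n : nat} (V : euclidean R n).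
Implicit Types u v w : V.

Lemma innerDr u v w : inner V u (v + w) = inner V u v + inner V u w.
Proof. by rewrite innerC innerDl !(innerC _ u). Qed.

Lemma innerZl (a : R) u v : inner V (a *: u) v = a * inner V u v.
Proof. exact: linearZl_LR. Qed.

Lemma innerZr (a : R) u v : inner V u (a *: v) = a * inner V u v.
Proof. by rewrite innerC innerZl innerC. Qed.

Lemma innerNr u v : inner V u (- v) = - inner V u v.
Proof. by rewrite innerC innerNl innerC. Qed.

Lemma innerBl u v w : inner V (u - v) w = inner V u w - inner V v w.
Proof. by rewrite innerDl innerNl. Qed.

Lemma inner_suml (I : Type) (s : seq I) (P : pred I) (F : I -> V) v :
  inner V (\sum_(i <- s | P i) F i) v = \sum_(i <- s | P i) inner V (F i) v.
Proof. exact: (big_morph _ (fun u w => innerDl u w v) (inner0l v)). Qed.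

Lemma onb_coord v : v = \sum_i inner V v (onb V i) *: onb V i.
Proof.
have [c vE] := onb_span v.
rewrite {1}vE; apply: eq_bigr => i _; congr (_ *: _).
rewrite vE inner_suml (bigD1 i)//= innerZl onb_orthonormal eqxx mulr1.
rewrite big1 ?addr0// => j /negbTE ji.
by rewrite innerZl onb_orthonormal ji mulr0.
Qed.

Lemma inner_coord u v :
  inner V u v = \sum_i inner V u (onb V i) * inner V v (onb V i).
Proof.
rewrite {1}(onb_coord u) inner_suml; apply: eq_bigr => i _.
by rewrite innerZl (innerC _ v).
Qed.

(** The triangle inequality comes with the normed space, so Cauchy-Schwarz is read off from it by
    squaring. *)
Lemma inner_le_norm u v : inner V u v <= `|u| * `|v|.
Proof.
have : `|u + v| ^+ 2 <= (`|u| + `|v|) ^+ 2.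
  by rewrite lerXn2r ?nnegrE ?addr_ge0 ?ler_normD.
rewrite sqrrD -!inner_sqr !(innerDl, innerDr) (innerC v u).
lra.
Qed.

Lemma norm_inner_le u v : `|inner V u v| <= `|u| * `|v|.
Proof.
rewrite ler_norml inner_le_norm andbT lerNl -innerNl.
by rewrite (le_trans (inner_le_norm _ _))// normrN.
Qed.

Lemma norm_onb i : `|onb V i| = 1.
Proof. by rewrite norm_inner onb_orthonormal eqxx sqrtr1. Qed.

End euclidean_theory.

Section continuity_within.
Context {R : realType} {T : topologicalType} (D : set T).

Lemma within_continuousD (W : normedModType R) (f g : T -> W) :
  {within D, continuous f} -> {within D, continuous g} ->
  {within D, continuous (fun x => f x + g x)}.
Proof.
move=> /subspace_continuousP cf /subspace_continuousP cg.
apply/subspace_continuousP => x Dx.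
by apply: cvgD; [exact: cf|exact: cg].
Qed.

Lemma within_continuousZ (W : normedModType R) (f : T -> W) (g : T -> R) :
  {within D, continuous f} -> {within D, continuous g} ->
  {within D, continuous (fun x => g x *: f x)}.
Proof.
move=> /subspace_continuousP cf /subspace_continuousP cg.
apply/subspace_continuousP => x Dx.
by apply: cvgZ; [exact: cg|exact: cf].
Qed.

Lemma within_continuous_cst (W : normedModType R) (w : W) :
  {within D, continuous (fun=> w)}.
Proof. by apply: continuous_subspaceT => x; exact: cvg_cst. Qed.

Lemma within_continuous_comp (W W' : topologicalType) (g : W -> W') (f : T -> W) :
  continuous g -> {within D, continuous f} -> {within D, continuous (g \o f)}.
Proof.
move=> cg /subspace_continuousP cf; apply/subspace_continuousP => x Dx.
by apply: (cvg_comp _ _ (cf _ Dx)); exact: cg.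
Qed.

Lemma within_continuous_sum (W : normedModType R) (I : Type) (s : seq I)
    (F : I -> T -> W) :
  (forall i, {within D, continuous (F i)}) ->
  {within D, continuous (fun x => \sum_(i <- s) F i x)}.
Proof.
move=> cF; elim: s => [|i s ih].
  by under eq_fun do rewrite big_nil; exact: within_continuous_cst.
by under eq_fun do rewrite big_cons; exact: within_continuousD.
Qed.

Lemma within_continuous_inner n (V : euclidean R n) (f g : T -> V) :
  {within D, continuous f} -> {within D, continuous g} ->
  {within D, continuous (fun x => inner V (f x) (g x))}.
Proof.
move=> cf cg; under eq_fun do rewrite inner_coord.
apply: within_continuous_sum => i.
apply: (@within_continuousZ R^o);
  exact: (within_continuous_comp (@inner_continuousl _ _ V (onb V i))).
Qed.

End continuity_within.

Section compact_integration.
Context {R : realType} {d : nat} (Omega : set 'rV[R]_d).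
Hypothesis compactOmega : compact Omega.

Lemma compact_within_bounded (W : normedModType R) (f : 'rV[R]_d -> W) :
  {within Omega, continuous f} ->
  exists2 M, 0 < M & forall x, Omega x -> `|f x| <= M.
Proof.
move=> cf; have [M [_ HM]] := compact_bounded (continuous_compact cf compactOmega).
exists (`|M| + 1) => [|x Ox]; first by rewrite ltr_wpDl.
apply: HM; last by exists x.
by rewrite (le_lt_trans (ler_norm _))// ltrDl.
Qed.

Lemma measurable_compact : measurable (Omega : set (borel R d)).
Proof.
rewrite -[X in measurable X]setCK; apply: measurableC.
apply: sub_sigma_algebra; rewrite openC.
by apply: compact_closed => //; exact: norm_hausdorff.
Qed.

Lemma within_continuous_measurable (f : 'rV[R]_d -> R) :
  {within Omega, continuous f} ->
  measurable_fun (Omega : set (borel R d)) (f : borel R d -> R).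
Proof.
move=> /continuousP cf; apply: (measurability _ (RGenOpens.measurableE R)).
move=> _ [_ [a [b ->] <-]].
have /open_subspaceP[U oU UE] := cf _ (@interval_open R (BRight a) (BLeft b) isT isT).
rewrite setIC -UE; apply: measurableI; last exact: measurable_compact.
exact: sub_sigma_algebra.
Qed.

Variables (d0 : measure_display) (T : measurableType d0).
Variables (m : {measure set T -> \bar R}) (h : T -> borel R d).
Hypothesis mh : measurable_fun setT h.
Hypothesis mfin : (m (h @^-1` Omega) < +oo)%E.

Lemma measurable_preimage_compact : measurable (h @^-1` Omega).
Proof. by rewrite -[X in measurable X]setTI; apply: mh => //; exact: measurable_compact. Qed.

(** The map [h] will be [Rd_row] for Lebesgue integrals and the identity for the Jordan parts of a
    signed measure. *)
Lemma compact_integrable (f : 'rV[R]_d -> R) : {within Omega, continuous f} ->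
  m.-integrable (h @^-1` Omega) (EFin \o (fun y => f (h y))).
Proof.
move=> cf; apply: measurable_bounded_integrable => //.
- exact: measurable_preimage_compact.
- apply: (@measurable_comp _ _ _ _ _ _ (Omega : set (borel R d))).
  + exact: measurable_compact.
  + by move=> _ [y hy <-].
  + exact: within_continuous_measurable.
  + exact: measurable_funTS.
- have [M _ HM] := compact_within_bounded cf.
  exists M; split; first exact: num_real.
  by move=> x Mx y hy; apply: le_trans (HM _ hy) (ltW Mx).
Qed.

End compact_integration.

(** * The weak gradient bound *)

Section gradient_bound.
Context {R : realType} {d n : nat} {V : euclidean R n}.
Variable Omega : set 'rV[R]_d.
Hypothesis compactOmega : compact Omega.
Implicit Types (phi : 'rV[R]_d -> V) (f g : 'rV[R]_d -> R).
Implicit Types (psi : 'rV[R]_d -> 'I_d -> V).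

Lemma lebesgue_Rd_compact :
  (lebesgue_Rd R d (@Rd_row R d @^-1` Omega) < +oo)%E.
Proof.
have [M [Mr HM]] := compact_bounded compactOmega.
apply: le_lt_trans (lebesgue_Rd_box d (M + 1)).
apply: le_measure; rewrite ?inE.
- exact: (measurable_preimage_compact compactOmega (@measurable_Rd_row R d)).
- exact: measurable_Rd_box.
- move=> y /= Oy j; apply: le_trans (coord_le_norm _ _) _.
  by apply: HM => //; rewrite ltrDl.
Qed.

Let L := lebesgue_Rd R d.
Let D := @Rd_row R d @^-1` Omega.

Lemma measurable_Rd_compact : measurable D.
Proof.
exact: (measurable_preimage_compact compactOmega (@measurable_Rd_row R d)).
Qed.

Definition rint_Rd f : R := (\int[L]_(y in D) f (Rd_row y))%R.

Lemma integrable_Rd f : {within Omega, continuous f} ->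
  L.-integrable D (EFin \o (fun y => f (Rd_row y))).
Proof.
move=> cf; apply: (compact_integrable compactOmega) => //.
  exact: measurable_Rd_row.
exact: lebesgue_Rd_compact.
Qed.

Lemma integral_RdE f : {within Omega, continuous f} ->
  integral_Rd Omega f = (rint_Rd f)%:E.
Proof.
move=> /integrable_Rd If; rewrite /rint_Rd /Rintegral fineK//.
exact: (integrable_fin_num measurable_Rd_compact If).
Qed.

Lemma rint_RdD f g :
  {within Omega, continuous f} -> {within Omega, continuous g} ->
  rint_Rd (fun x => f x + g x) = rint_Rd f + rint_Rd g.
Proof.
by move=> cf cg; apply: RintegralD;
  [exact: measurable_Rd_compact|exact: integrable_Rd..].
Qed.

Lemma rint_RdZ (a : R) f : {within Omega, continuous f} ->
  rint_Rd (fun x => a * f x) = a * rint_Rd f.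
Proof.
by move=> cf; apply: RintegralZl;
  [exact: measurable_Rd_compact|exact: integrable_Rd].
Qed.

Lemma rint_Rd_le f g :
  {within Omega, continuous f} -> {within Omega, continuous g} ->
  (forall x, Omega x -> f x <= g x) -> rint_Rd f <= rint_Rd g.
Proof.
by move=> cf cg fg; apply: le_Rintegral;
  [exact: measurable_Rd_compact|exact: integrable_Rd..|move=> y; exact: fg].
Qed.

Lemma continuous_divergence psi :
  test_field Omega psi -> continuous (divergence psi).
Proof.
move=> [spsi _ _] x; apply: differentiable_continuous.
rewrite /divergence -fct_sumE; apply: differentiable_sum => l.
exact: (spsi l [:: l] x).
Qed.

Lemma within_continuous_divergence psi phi : {within Omega, continuous phi} ->
  test_field Omega psi ->
  {within Omega, continuous (fun x => inner V (phi x) (divergence psi x))}.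
Proof.
move=> cphi tpsi; apply: within_continuous_inner => //.
exact: continuous_subspaceT (continuous_divergence tpsi).
Qed.

Definition unit_test_field psi := test_field Omega psi /\
  (integral_Rd Omega (fun x => norm_pow (psi x)) <= 1)%E.

Definition weak_lip1 phi := {within Omega, continuous phi} /\
  (grad_norm Omega phi <= 1)%E.

(** Integrals of continuous functions over [Omega] are finite, so the extended supremum amounts to a
    family of real inequalities, each linear in [phi]. *)
Lemma grad_norm_le1 phi : {within Omega, continuous phi} ->
  (grad_norm Omega phi <= 1)%E <-> (forall psi, unit_test_field psi ->
    rint_Rd (fun x => inner V (phi x) (divergence psi x)) <= 1).
Proof.
move=> cphi; split => [gphi psi [tpsi psi1]|H].
  rewrite -lee_fin -integral_RdE; last exact: within_continuous_divergence.
  by apply: le_trans gphi; apply: ereal_sup_ubound; exists psi.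
apply: ge_ereal_sup => _ [psi [tpsi psi1] <-].
rewrite integral_RdE ?lee_fin; first exact: H.
exact: within_continuous_divergence.
Qed.

(** Asking only a + b <= 1 covers both convex combinations and shrinking. *)
Lemma weak_lip1_comb phi phi' (a b : R) : 0 <= a -> 0 <= b -> a + b <= 1 ->
  weak_lip1 phi -> weak_lip1 phi' -> weak_lip1 (fun x => a *: phi x + b *: phi' x).
Proof.
move=> a0 b0 ab1 [cphi gphi] [cphi' gphi'].
have cc : {within Omega, continuous (fun x => a *: phi x + b *: phi' x)}.
  by apply: within_continuousD; apply: within_continuousZ => //;
    exact: within_continuous_cst.
split => //; apply/grad_norm_le1 => // psi upsi; have [tpsi _] := upsi.
under eq_fun do rewrite innerDl !innerZl.
have cM (e : R) (chi : 'rV[R]_d -> V) : {within Omega, continuous chi} ->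
    {within Omega, continuous (fun x => e * inner V (chi x) (divergence psi x))}.
  move=> cchi; apply: (@within_continuousZ R _ _ R^o).
    exact: within_continuous_divergence.
  exact: within_continuous_cst.
rewrite rint_RdD; [|exact: cM..].
rewrite !rint_RdZ; [|exact: within_continuous_divergence..].
have := (grad_norm_le1 cphi).1 gphi _ upsi.
have := (grad_norm_le1 cphi').1 gphi' _ upsi.
move=> /(ler_wpM2l b0) Hb /(ler_wpM2l a0) Ha.
by rewrite (le_trans (lerD Ha Hb))// !mulr1.
Qed.

Lemma weak_lip1_0 : weak_lip1 (fun=> 0).
Proof.
have c0 : {within Omega, continuous (fun _ : 'rV[R]_d => 0 : V)}.
  exact: within_continuous_cst.
split => //; apply/grad_norm_le1 => // psi _.
under eq_fun do rewrite inner0l -[0](mul0r 0).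
by rewrite rint_RdZ ?mul0r//; exact: (@within_continuous_cst _ _ _ R^o).
Qed.

Lemma weak_lip1_scale phi (a : R) : 0 <= a <= 1 ->
  weak_lip1 phi -> weak_lip1 (fun x => a *: phi x).
Proof.
move=> /andP[a0 a1] lphi.
have := weak_lip1_comb a0 (lexx 0) _ lphi lphi; rewrite addr0 => /(_ a1).
by under eq_fun do rewrite scale0r addr0.
Qed.

Lemma weak_lip1_closed phi : {within Omega, continuous phi} ->
  (forall e, 0 < e -> exists2 phi', weak_lip1 phi' &
     forall x, Omega x -> `|phi x - phi' x| <= e) ->
  weak_lip1 phi.
Proof.
move=> cphi H; split => //; apply/grad_norm_le1 => // psi upsi.
have [tpsi _] := upsi.
have cdiv : {within Omega, continuous (divergence psi)}.
  exact: continuous_subspaceT (continuous_divergence tpsi).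
have cnorm : {within Omega, continuous (fun x => `|divergence psi x|)}.
  by apply: (within_continuous_comp _ cdiv); exact: norm_continuous.
pose C := rint_Rd (fun x => `|divergence psi x|).
have C0 : 0 <= C by apply: Rintegral_ge0 => y _.
apply/ler_addgt0Pr => e e0.
have C1 : 0 < C + 1 by rewrite ltr_wpDl.
have [phi' [cphi' gphi'] HH] := H (e / (C + 1)) (divr_gt0 e0 C1).
have := (grad_norm_le1 cphi').1 gphi' _ upsi.
have cM (a : R) : {within Omega, continuous (fun x => a * `|divergence psi x|)}.
  apply: (@within_continuousZ R _ _ R^o) => //; exact: within_continuous_cst.
have : rint_Rd (fun x => inner V (phi x) (divergence psi x)) <=
    rint_Rd (fun x => inner V (phi' x) (divergence psi x) +
      e / (C + 1) * `|divergence psi x|).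
  apply: rint_Rd_le.
  - exact: within_continuous_divergence.
  - apply: (@within_continuousD R _ _ R^o) => //.
    exact: within_continuous_divergence.
  move=> x Ox; rewrite -lerBlDl -innerBl (le_trans (inner_le_norm _ _))//.
  by rewrite ler_wpM2r// HH.
rewrite rint_RdD//; last exact: within_continuous_divergence.
rewrite rint_RdZ// -/C => H1 H2; apply: le_trans H1 _; apply: lerD => //.
by rewrite mulrAC ler_pdivrMr// ler_wpM2l ?ltW// ltrDl.
Qed.

End gradient_bound.

(** * The gradient bound tested along a coordinate axis *)

Section axis_estimate.
Context {R : realType} {d n : nat} {V : euclidean R n} {Omega : set 'rV[R]_d}.
Hypothesis compactOmega : compact Omega.

Lemma is_derive_shift (F : R -> R) (c x df : R) :
  is_derive (x - c) 1 F df -> is_derive x 1 (fun s : R => F (s - c)) df.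
Proof.
move=> dF; have ds : is_derive x 1 (fun s : R => s - c) 1.
  apply: is_derive_eq (is_deriveB (is_derive_id x 1) (is_derive_cst c x 1)) _.
  by rewrite subr0.
by have := @is_derive1_comp _ F (fun s : R => s - c) _ _ _ dF ds; rewrite mulr1.
Qed.

Lemma is_derive_continuous (F f : R -> R) :
  (forall x : R, is_derive x 1 F (f x)) -> continuous F.
Proof.
move=> dF x; apply: differentiable_continuous.
exact/derivable1_diffP/(ex_derive (is_derive := dF x)).
Qed.

Lemma integral_shifted_bump (F f : R -> R) (r c : R) : 0 < r ->
  (forall x : R, is_derive x 1 F (f x)) -> continuous f ->
  F 0 = 0 -> F r = 1 -> (forall x, f x != 0 -> 0 < x < r) ->
  (\int[lebesgue_measure]_s (f (s - c)%R)%:E = 1)%E.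
Proof.
move=> r0 dF cf F0 Fr supp.
have dFc (x : R) := is_derive_shift (dF (x - c)).
have cFc := is_derive_continuous dFc.
have cfc : continuous (fun s => f (s - c)).
  move=> x; apply: (@continuous_comp _ _ _ (fun s : R => s - c) f); last exact: cf.
  by apply: cvgB; [exact: cvg_id|exact: cvg_cst].
have cr : c < c + r by rewrite ltrDl.
transitivity (\int[lebesgue_measure]_(s in `[c, (c + r)%R]) (f (s - c)%R)%:E)%E.
  rewrite [RHS]integral_mkcond; apply: eq_integral => s _.
  rewrite patchE; case: ifPn => // /negP scr; congr (_%:E).
  apply/eqP/negPn/negP => /supp; rewrite subr_gt0 ltrBlDl => /andP[s1 s2].
  by apply: scr; rewrite inE/= in_itv/= !ltW.
rewrite (continuous_FTC2 cr (F := fun s => F (s - c))).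
- by rewrite (_ : c + r - c = r) ?subrr ?F0 ?Fr ?sube0//; ring.
- exact: continuous_subspaceT.
- split; first by move=> x _; exact: (ex_derive (is_derive := dFc x)).
  + exact/cvg_at_right_filter/cFc.
  + exact/cvg_at_left_filter/cFc.
- by move=> x _; rewrite derive1E (derive_val (is_derive := dFc x)).
Qed.

(* The test field is [psi = f v e_l] with [f] a mollified indicator of the
   segment [p, p + h e_l]: its [l]-th derivative is the difference of two bumps,
   at [p] and at [p + h e_l], and its mass is about [h]. *)
Lemma axis_estimate (phi : 'rV[R]_d -> V) (p : 'rV[R]_d) (l : 'I_d) (h r e : R) (u : V) :
  weak_lip1 Omega phi -> 0 <= h -> 0 < r -> 0 <= e -> `|u| <= 1 ->
  (forall z : 'rV[R]_d, (forall j, p 0 j <= z 0 j <= p 0 j + (j == l)%:R * h + r) ->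
    Omega° z) ->
  (forall z : 'rV[R]_d, (forall j, p 0 j <= z 0 j <= p 0 j + r) ->
    `|phi z - phi p| <= e) ->
  (forall z : 'rV[R]_d, (forall j, p 0 j + (j == l)%:R * h <= z 0 j
                     <= p 0 j + (j == l)%:R * h + r) ->
    `|phi z - phi (p + h *: delta_mx 0 l)| <= e) ->
  inner V (phi p - phi (p + h *: delta_mx 0 l)) u <= h + r + e *+ 2.
Proof.
move=> lphi h0 r0 e0 u1 boxO near_p near_q.
have [cphi gphi] := lphi.
have [G [dG G01 Gle0 Gger G1]] := smooth_step_exists r0.
set q := p + h *: delta_mx 0 l in near_q *.
have qE j : q 0 j = p 0 j + (j == l)%:R * h.
  by rewrite !mxE eqxx/= mulrC.
have dGs k (c x : R) := is_derive_shift (dG k (x - c)).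
have cGs k c := is_derive_continuous (dGs k c).
(* Along [l] the difference of two steps is a smoothed indicator supported in [p_l, q_l + r]. In the
   other directions the factor is the unit-mass bump [G 1], so the tower starts one order higher
   there. *)
pose T j k s := if j == l then G k (s - p 0 l) - G k (s - q 0 l)
                else G k.+1 (s - p 0 j).
have dT j k (y : R) : is_derive y 1 (T j k) (T j k.+1 y).
  rewrite /T; case: ifP => _; last exact: dGs.
  by apply: is_deriveB; exact: dGs.
pose f := prod_fun (fun j => T j 0%N).
pose bump (c : 'rV[R]_d) := prod_fun (fun j s => G 1%N (s - c 0 j)).
have hr0 : 0 < h + r by rewrite ltr_wpDl.
(* The field with [u] in place of [v] has mass at most h + r; this factor makes [psi] a unit test
   field. *)
pose v := (h + r)^-1 *: u.
have v1 : `|v| <= (h + r)^-1.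
  by rewrite normrZ gtr0_norm ?invr_gt0// ler_piMr// invr_ge0 ltW.
pose psi x l' := if l' == l then f x *: v else 0.
have supp_f x j : f x != 0 -> p 0 j <= x 0 j <= p 0 j + (j == l)%:R * h + r.
  move=> fx; have : T j 0%N (x 0 j) != 0.
    by apply: contraNneq fx => Tj0; rewrite /f /prod_fun (bigD1 j)//= Tj0 mul0r.
  rewrite /T; have [->|_] := eqVneq j l.
    rewrite qE eqxx mul1r => T0; apply/andP; split; rewrite leNgt; apply: contraNN T0 => xl.
      by rewrite !Gle0 ?subrr//; lra.
    by rewrite !Gger ?subrr//; lra.
  by rewrite mul0r addr0 => /(G1 _).2 /andP[]; lra.
have tpsi : test_field Omega psi.
  pose B := [set z : 'rV[R]_d | forall j,
    z 0 j \in `[p 0 j, (p 0 j + (j == l)%:R * h + r)]].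
  have cB : compact B.
    by apply: (@rV_compact R d (fun j => `[p 0 j, (p 0 j + (j == l)%:R * h + r)]%classic))
      => j; exact: segment_compact.
  have sB : field_support psi `<=` B.
    rewrite /field_support (closure_id B).1; last first.
      by apply: compact_closed cB; exact: norm_hausdorff.
    apply: closure_subset => z [l']; rewrite /psi.
    have [_|_] := eqVneq l' l; last by rewrite eqxx.
    rewrite scaler_eq0 negb_or => /andP[fz _] j.
    by rewrite in_itv/= supp_f.
  split.
  - move=> l'; rewrite /psi; case: eqP => _; last exact: smooth0.
    exact: (smooth_prod_fun (fun=> 0%N) v dT).
  - by apply: subclosed_compact cB sB; exact: closed_closure.
  - by move=> z /sB Bz; apply: boxO => j; have := Bz j; rewrite in_itv.
have bump_int c : (\int[lebesgue_Rd R d]_y (bump c (Rd_row y))%:E = 1)%E.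
  rewrite (integral_Rd_prod_fun (c := fun=> 1)).
  - by rewrite big1.
  - by move=> j; apply: continuous_measurable_fun; exact: cGs.
  - by move=> j s; have [] := G1 (s - c 0 j).
  - move=> j /=; apply: (@integral_shifted_bump (G 0%N) (G 1%N) r (c 0 j) r0 (dG 0%N)).
    + exact: (is_derive_continuous (dG 1%N)).
    + exact: Gle0.
    + exact: Gger.
    + by move=> x; have [] := G1 x.
have mprod (g : 'I_d -> R -> R) A : (forall j, measurable_fun setT (g j)) ->
    measurable_fun A (fun y : Rd R d => prod_fun g (Rd_row y)).
  move=> mg; apply: measurable_funTS; apply: measurable_prod => j _.
  exact: (measurableT_comp (mg j) (measurable_Rd_coord j)).
have mG k c : measurable_fun setT (fun s : R => G k (s - c)).
  by apply: continuous_measurable_fun; exact: cGs.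
have mT j : measurable_fun setT (T j 0%N).
  by rewrite /T; case: (j == l); [exact: measurable_funB|exact: mG].
have mD := measurable_Rd_compact compactOmega.
have norm_psi x : norm_pow (psi x) = `|v| * `|f x|.
  rewrite /norm_pow /inner_pow (bigD1 l)//= big1 => [|l' /negbTE l'l]; last first.
    by rewrite /psi l'l inner0l.
  by rewrite addr0 -norm_inner /psi eqxx normrZ mulrC.
have upsi : unit_test_field Omega psi.
  split => //.
  (* Replacing the factor along [l] by the indicator of an interval of length h + r gives a product
     majorant of |f| whose integral is exactly h + r. *)
  pose g j s := if j == l then \1_`[p 0 l, p 0 l + (h + r)] s
                else G 1%N (s - p 0 j).
  have mg j : measurable_fun setT (g j).
    by rewrite /g; case: (j == l); [exact: measurable_indic|exact: mG].
  have g0 j s : 0 <= g j s.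
    by rewrite /g; case: (j == l); [rewrite indicE|case: (G1 (s - p 0 j))].
  have gint : (\int[lebesgue_Rd R d]_y (prod_fun g (Rd_row y))%:E = (h + r)%:E)%E.
    rewrite (@integral_Rd_prod_fun _ _ _ (fun j => if j == l then h + r else 1))//.
      by rewrite (bigD1 l)//= eqxx big1 ?mulr1// => j /negbTE ->.
    move=> j; rewrite /g; case: ifP => _.
      rewrite integral_indic// setIT.
      transitivity (@lebesgue_measure R `[p 0 l, p 0 l + (h + r)]%classic) => //.
      rewrite lebesgue_measure_itv/= lte_fin ltrDl hr0.
      by rewrite -EFinD addrC addKr.
    apply: (@integral_shifted_bump (G 0%N) (G 1%N) r (p 0 j) r0 (dG 0%N)).
    + exact: (is_derive_continuous (dG 1%N)).
    + exact: Gle0.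
    + exact: Gger.
    + by move=> x; have [] := G1 x.
  have fg x : `|f x| <= prod_fun g x.
    rewrite /f /prod_fun normr_prod; apply: ler_prod => j _; rewrite normr_ge0/=.
    rewrite /T /g; have [->|_] := eqVneq j l; last first.
      by rewrite ger0_norm//; have [] := G1 (x 0 j - p 0 j).
    have [T0|T0] := eqVneq (G 0%N (x 0 l - p 0 l) - G 0%N (x 0 l - q 0 l)) 0.
      by rewrite T0 normr0 indicE.
    rewrite indicE mem_set.
      have /andP[a0 a1] := G01 (x 0 l - p 0 l).
      have /andP[b0 b1] := G01 (x 0 l - q 0 l).
      by rewrite mulr1n ler_norml; apply/andP; split; lra.
    rewrite /= in_itv/=; apply/andP; split; rewrite leNgt; apply: contraNN T0 => xl.
      by rewrite !Gle0 ?subrr//; rewrite ?qE ?eqxx ?mul1r; lra.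
    by rewrite !Gger ?subrr//; rewrite ?qE ?eqxx ?mul1r; lra.
  rewrite /integral_Rd.
  apply: (@le_trans _ _ (\int[lebesgue_Rd R d]_(y in @Rd_row R d @^-1` Omega)
      ((h + r)^-1%:E * (prod_fun g (Rd_row y))%:E)))%E.
    apply: ge0_le_integral => //.
    - by move=> y _; rewrite lee_fin sqrtr_ge0.
    - apply/measurable_EFinP; under eq_fun do rewrite norm_psi.
      apply: measurable_funM => //; apply: measurableT_comp => //.
      exact: mprod.
    - by apply/measurable_EFinP; apply: measurable_funM => //; exact: mprod.
    - by move=> y _; rewrite -EFinM lee_fin norm_psi ler_pM.
  rewrite ge0_integralZl//.
  - rewrite -(@mulVf _ (h + r)) ?gt_eqF// EFinM -gint.
    rewrite lee_pmul2l// ?lte_fin ?invr_gt0//.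
    apply: ge0_subset_integral => //.
    + by apply/measurable_EFinP; exact: mprod.
    + by move=> y _; rewrite lee_fin prodr_ge0.
  - by apply/measurable_EFinP; exact: mprod.
  - by move=> y _; rewrite lee_fin prodr_ge0.
  - by rewrite lee_fin invr_ge0 ltW.
have divE x : divergence psi x = (bump p x - bump q x) *: v.
  rewrite /divergence (bigD1 l)//= big1 => [|l' /negbTE l'l]; last first.
    rewrite /partial (_ : psi^~ l' = fun=> 0) ?derive_cst//.
    by apply/funext => y; rewrite /psi l'l.
  rewrite addr0 /partial (_ : psi^~ l = fun x => f x *: v); last first.
    by apply/funext => y; rewrite /psi eqxx.
  have df := @is_derive_prod_fun R d (fun j => T j 0%N) l (T l 1%N) x (dT l 0%N).
  rewrite derive_scalel; last exact: (ex_derive (is_derive := df)).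
  rewrite (derive_val (is_derive := df)); congr (_ *: _).
  rewrite /bump /prod_fun !(bigD1 (P := xpredT) l)//= eqxx /T eqxx mulrBl.
  congr (_ * _ - _ * _); apply: eq_bigr => j /negbTE jl; rewrite jl//.
  by rewrite qE jl mul0r addr0.
have supp_bump c x j : bump c x != 0 -> c 0 j <= x 0 j <= c 0 j + r.
  move=> bx; have : G 1%N (x 0 j - c 0 j) != 0.
    by apply: contraNneq bx => Tj0; rewrite /bump /prod_fun (bigD1 j)//= Tj0 mul0r.
  by move=> /(G1 _).2 /andP[? ?]; apply/andP; split; lra.
have bump_ge0 c x : 0 <= bump c x.
  by apply: prodr_ge0 => j _; have [] := G1 (x 0 j - c 0 j).
have cbump c : {within Omega, continuous (bump c)}.
  apply: continuous_subspaceT => x; apply: differentiable_continuous.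
  by apply: differentiable_prod_fun => j y; exact: (ex_derive (is_derive := dGs _ _ _)).
have bump_rint (c : 'rV[R]_d) : (forall z : 'rV[R]_d,
    (forall j, c 0 j <= z 0 j <= c 0 j + r) -> Omega z) ->
    rint_Rd Omega (bump c) = 1.
  move=> cO; rewrite /rint_Rd /Rintegral -[RHS]/(fine 1%E) -(bump_int c).
  congr fine; rewrite integral_mkcond; apply: eq_integral => y _.
  rewrite patchE; case: ifPn => //; rewrite notin_setE => yO; congr (_%:E).
  by apply/esym/eqP/negPn/negP => by0; apply: yO; apply: cO => j; exact: supp_bump.
have int_sub := @interior_subset _ Omega.
have bump_p : rint_Rd Omega (bump p) = 1.
  apply: bump_rint => z pz; apply: int_sub; apply: boxO => j.
  have /andP[-> z2] := pz j; apply: (le_trans z2).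
  by rewrite lerD2r lerDl mulr_ge0.
have bump_q : rint_Rd Omega (bump q) = 1.
  apply: bump_rint => z qz; apply: int_sub; apply: boxO => j.
  have := qz j; rewrite qE => /andP[z1 ->]; rewrite andbT (le_trans _ z1)//.
  by rewrite lerDl mulr_ge0.
have := (grad_norm_le1 compactOmega cphi).1 gphi _ upsi.
(* On the supports of the bumps [phi] differs from its values at [p] and [q] by at most [e], and |v|
   <= 1/(h + r); hence <phi, div psi> >= a bump_p - b bump_q. *)
set a := inner V (phi p) v - e / (h + r).
set b := inner V (phi q) v + e / (h + r).
have close c z : `|phi z - phi c| <= e ->
    `|inner V (phi z) v - inner V (phi c) v| <= e / (h + r).
  move=> zc; rewrite -innerBl (le_trans (norm_inner_le _ _))//.
  by rewrite ler_pM.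
have cZ (k : R) c : {within Omega, continuous (fun x => k * bump c x)}.
  apply: (@within_continuousZ R _ _ R^o) => //; exact: within_continuous_cst.
have le1 : rint_Rd Omega (fun x => a * bump p x + (- b) * bump q x) <=
    rint_Rd Omega (fun x => inner V (phi x) (divergence psi x)).
  apply: rint_Rd_le => //.
  - exact: (@within_continuousD R _ _ R^o).
  - exact: within_continuous_divergence.
  move=> x Ox; rewrite divE innerZr [leRHS]mulrBl mulNr; apply: lerB.
    have [->|bx] := eqVneq (bump p x) 0; first by rewrite mulr0 mul0r.
    rewrite mulrC ler_wpM2l//.
    have /close : `|phi x - phi p| <= e by apply: near_p => j; exact: supp_bump.
    by rewrite ler_norml /a => /andP[? ?]; lra.
  have [->|bx] := eqVneq (bump q x) 0; first by rewrite mulr0 mul0r.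
  rewrite [leRHS]mulrC ler_wpM2l//.
  have /close : `|phi x - phi q| <= e.
    by apply: near_q => j; rewrite -qE; exact: supp_bump.
  by rewrite ler_norml /b => /andP[? ?]; lra.
move=> /(le_trans le1).
rewrite rint_RdD// !rint_RdZ// bump_p bump_q !mulr1 /a /b !innerZr => le2.
have : (h + r)^-1 * (inner V (phi p) u - inner V (phi q) u) <= 1 + e *+ 2 / (h + r).
  rewrite mulrBr mulrnAl mulr2n; lra.
rewrite innerBl ler_pdivrMl// mulrDr mulr1 [_ * (_ / _)]mulrC divfK//.
by rewrite gt_eqF.
Qed.

End axis_estimate.

(** * From the weak gradient bound to a global Lipschitz estimate *)

Section lipschitz.
Context {R : realType} {d n : nat} {V : euclidean R n} {Omega : set 'rV[R]_d}.
Hypothesis compactOmega : compact Omega.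
Hypothesis convexOmega :
  convex_set (Omega : set (convex_lmodType 'rV[R]_d)).
Hypothesis interiorOmega : Omega° !=set0.

Lemma rV_subE (x y : 'rV[R]_d) j : (x - y) 0 j = x 0 j - y 0 j.
Proof. by rewrite !mxE. Qed.

Lemma convex_comb (x y : 'rV[R]_d) t : Omega x -> Omega y -> 0 <= t <= 1 ->
  Omega (t *: x + (1 - t) *: y).
Proof.
move=> Ox Oy /andP[t0 t1].
have := @convexOmega x y (Itv01 t0 t1); rewrite !inE; apply => //.
Qed.

Lemma within_continuousE (phi : 'rV[R]_d -> V) p e :
  {within Omega, continuous phi} -> Omega p -> 0 < e ->
  exists2 r, 0 < r & forall z, Omega z -> `|z - p| < r -> `|phi z - phi p| <= e.
Proof.
move=> /subspace_continuousP cphi Op e0.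
have /cvgr_dist_le /(_ e e0) := cphi p Op.
rewrite near_withinE => /nbhs_normP[r /= r0 H].
exists r => // z Oz zr; rewrite distrC; apply: H => //.
by rewrite /ball_/= distrC.
Qed.

Lemma interior_cube (c : 'rV[R]_d) rho :
  (forall z, `|z - c| < rho -> Omega z) ->
  forall z, `|z - c| < rho -> Omega° z.
Proof.
move=> cube z zc; apply/nbhs_ballP; exists (rho - `|z - c|) => /=.
  by rewrite subr_gt0.
move=> y; rewrite mx_norm_ball /ball_/= ltrBrDr => yz; apply: cube.
by rewrite -(subrKA z) (le_lt_trans (ler_normD _ _))// distrC.
Qed.

(** The limit of [axis_estimate] as the width of the bumps and the oscillation of [phi] on their
    supports tend to 0. *)
Lemma axis_lipschitz (phi : 'rV[R]_d -> V) (c p : 'rV[R]_d) rho l h u :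
  weak_lip1 Omega phi -> `|u| <= 1 -> 0 <= h ->
  (forall z, `|z - c| < rho -> Omega z) ->
  `|p - c| < rho -> `|p + h *: delta_mx 0 l - c| < rho ->
  inner V (phi p - phi (p + h *: delta_mx 0 l)) u <= h.
Proof.
move=> lphi u1 h0 cube pc; set q := p + _ => qc.
have qE j : q 0 j = p 0 j + (j == l)%:R * h by rewrite !mxE eqxx/= mulrC.
have [cphi _] := lphi.
apply/ler_addgt0Pr => e e0.
have e4 : 0 < e / 4%:R by rewrite divr_gt0.
have [r1 r1_gt0 H1] := within_continuousE cphi (cube _ pc) e4.
have [r2 r2_gt0 H2] := within_continuousE cphi (cube _ qc) e4.
have qc0 : 0 < rho - `|q - c| by rewrite subr_gt0.
(* The boxes extend only upwards, so [r] has to fit between [q] and the upper faces of the cube,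
   while the position of [p] settles the lower faces. The error is r <= e/2 plus twice the
   oscillation e/4; the final halving makes the inequalities strict. *)
pose r := Num.min (Num.min r1 r2) (Num.min (rho - `|q - c|) (e / 2)) / 2.
have r0 : 0 < r.
  by rewrite divr_gt0// !lt_min r1_gt0 r2_gt0 qc0 divr_gt0.
have r1r : r < r1.
  by rewrite /r ltr_pdivrMr// (le_lt_trans (y := r1)) ?ge_min ?lexx//; lra.
have r2r : r < r2.
  by rewrite /r ltr_pdivrMr// (le_lt_trans (y := r2)) ?ge_min ?lexx ?orbT//; lra.
have rqc : r < rho - `|q - c|.
  rewrite /r ltr_pdivrMr// (le_lt_trans (y := rho - `|q - c|)) ?ge_min ?lexx ?orbT//.
  lra.
have re : r <= e / 2.
  rewrite /r ler_pdivrMr// (le_trans (y := e / 2)) ?ge_min ?lexx ?orbT//; lra.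
have rho0 : 0 < rho by apply: le_lt_trans pc.
have boxO (z : 'rV[R]_d) : (forall j, p 0 j <= z 0 j <= p 0 j + (j == l)%:R * h + r) ->
    `|z - c| < rho.
  move=> zbox; apply: rV_norm_lt => // j; have /andP[z1 z2] := zbox j.
  have := le_lt_trans (coord_le_norm _ j) pc; have := coord_le_norm (q - c) j.
  rewrite -qE in z2; rewrite !rV_subE => qj; rewrite ltr_norml => /andP[p1 _].
  rewrite ltr_norml; apply/andP; split; first by lra.
  by move: qj; rewrite ler_norml => /andP[_ qj]; lra.
have small (w z : 'rV[R]_d) : (forall j, w 0 j <= z 0 j <= w 0 j + r) -> `|z - w| <= r.
  move=> H; apply: rV_norm_le; first exact: ltW.
  move=> j; have /andP[w1 w2] := H j; rewrite !mxE ger0_norm ?subr_ge0//.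
  by rewrite lerBlDl.
apply: le_trans (@axis_estimate _ _ _ _ _ compactOmega phi p l h r (e / 4%:R) u
  lphi h0 r0 (ltW e4) u1 _ _ _) _.
- by move=> z /boxO; exact: interior_cube.
- move=> z H; apply: H1.
    apply: cube; apply: boxO => j; have /andP[-> z2] := H j.
    by rewrite (le_trans z2)// lerD2r lerDl mulr_ge0.
  exact: le_lt_trans (small _ _ H) r1r.
- move=> z H; rewrite -/q; apply: H2.
    apply: cube; apply: boxO => j; have /andP[z1 ->] := H j.
    by rewrite andbT (le_trans _ z1)// lerDl mulr_ge0.
  apply: le_lt_trans (small _ _ _) r2r => j.
  by rewrite qE; exact: H.
by rewrite -addrA lerD2l mulr2n; lra.
Qed.

(** Pairing with the unit vector along phi p - phi q reduces to scalar estimates. The coordinates of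
    [p] are replaced by those of [q] one at a time: the hybrid points stay in the cube, a ball of
    the sup norm, and each of the [d] steps costs at most |p - q|. *)
Lemma cube_lipschitz (phi : 'rV[R]_d -> V) (c p q : 'rV[R]_d) rho :
  weak_lip1 Omega phi -> (forall z, `|z - c| < rho -> Omega z) ->
  `|p - c| < rho -> `|q - c| < rho ->
  `|phi p - phi q| <= d%:R * `|p - q|.
Proof.
move=> lphi cube pc qc.
have [->|pq] := eqVneq (phi p) (phi q).
  by rewrite subrr normr0 mulr_ge0.
have N0 : `|phi p - phi q| != 0 by rewrite normr_eq0 subr_eq0.
pose u := `|phi p - phi q|^-1 *: (phi p - phi q).
have u1 : `|u| <= 1.
  by rewrite /u normrZ normrV ?unitfE// normr_id mulVf.
suff : inner V (phi p - phi q) u <= d%:R * `|p - q|.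
  by rewrite innerZr inner_sqr expr2 mulrA mulVf// mul1r.
(* A negative step is a positive one with the endpoints exchanged and [u] replaced by [- u]. *)
have signed (w : 'rV[R]_d) l h : `|w - c| < rho -> `|w + h *: delta_mx 0 l - c| < rho ->
    inner V (phi w - phi (w + h *: delta_mx 0 l)) u <= `|h|.
  move=> wc; set w' := w + _ => w'c; have [h0|h0] := leP 0 h.
    by rewrite ger0_norm//; exact: (axis_lipschitz (c := c) (rho := rho)).
  have w'E : w = w' + (- h) *: delta_mx 0 l by rewrite scaleNr addrK.
  rewrite -opprB innerNl -innerNr {1}w'E ltr0_norm//.
  apply: (axis_lipschitz (c := c) (rho := rho)) => //.
  - by rewrite normrN.
  - by rewrite oppr_ge0 ltW.
  - by rewrite -w'E.
pose w k : 'rV[R]_d := \row_j (if (j < k)%N then q 0 j else p 0 j).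
have w0 : w 0%N = p by apply/rowP => j; rewrite mxE ltn0.
have wd : w d = q by apply/rowP => j; rewrite mxE ltn_ord.
have wc k : `|w k - c| < rho.
  apply: rV_norm_lt; first exact: le_lt_trans pc.
  move=> j; rewrite !mxE; case: ifP => _.
    by have := le_lt_trans (coord_le_norm _ j) qc; rewrite !mxE.
  by have := le_lt_trans (coord_le_norm _ j) pc; rewrite !mxE.
suff H k : (k <= d)%N -> inner V (phi p - phi (w k)) u <= k%:R * `|p - q|.
  by rewrite -{1}wd; exact: H.
elim: k => [_|k ih kd]; first by rewrite w0 subrr inner0l mul0r.
rewrite -(subrKA (phi (w k))) innerDl -natr1 mulrDl mul1r lerD//.
  by apply: ih; exact: ltnW.
have wS : w k.+1 = w k + (q 0 (Ordinal kd) - p 0 (Ordinal kd)) *: delta_mx 0 (Ordinal kd).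
  apply/rowP => j; rewrite !mxE eqxx/= ltnS leq_eqVlt.
  have [jk|jk] := eqVneq j (Ordinal kd).
    by rewrite jk/= eqxx ltnn mulr1 addrC subrK.
  have -> : (val j == k) = false.
    by apply/negbTE; apply: contraNN jk => /eqP jk; apply/eqP/val_inj.
  by rewrite mulr0 addr0.
rewrite wS; apply: le_trans (signed _ _ _ _ _) _ => //; first by rewrite -wS.
by have := coord_le_norm (p - q) (Ordinal kd); rewrite !mxE distrC.
Qed.

(** By convexity every point of the segment has its [rho]-cube inside [Omega]. Pieces shorter than
    [rho] fall under the local estimate, and the lengths of collinear pieces add up to |x - y|
    without loss. *)
Lemma interior_lipschitz (phi : 'rV[R]_d -> V) (x y : 'rV[R]_d) rho :
  weak_lip1 Omega phi -> 0 < rho ->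
  (forall z, `|z - x| < rho -> Omega z) ->
  (forall z, `|z - y| < rho -> Omega z) ->
  `|phi x - phi y| <= d%:R * `|x - y|.
Proof.
move=> lphi rho0 Ox Oy.
have tube t c z : 0 <= t <= 1 -> c = t *: x + (1 - t) *: y -> `|z - c| < rho -> Omega z.
  move=> t01 cE zc.
  have -> : z = t *: (z - c + x) + (1 - t) *: (z - c + y).
    rewrite [t *: (_ + x)]scalerDr [(1 - t) *: (_ + y)]scalerDr addrACA.
    by rewrite -scalerDl subrKC scale1r -cE subrK.
  by apply: convex_comb => //; [apply: Ox|apply: Oy]; rewrite addrK.
pose m := Num.bound (`|x - y| / rho).
have mp : `|x - y| / m.+1%:R < rho.
  rewrite ltr_pdivrMr// -ltr_pdivrMl// mulrC.
  apply: lt_trans (_ : m%:R < _); last by rewrite ltr_nat.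
  by apply: archi_boundP; rewrite divr_ge0// ltW.
pose s k : R := k%:R / m.+1%:R.
pose X k := (1 - s k) *: x + s k *: y.
have s01 k : (k <= m.+1)%N -> 0 <= s k <= 1.
  by move=> km; rewrite divr_ge0//= ler_pdivrMr// mul1r ler_nat.
have sS k : s k.+1 = s k + m.+1%:R^-1 by rewrite /s -[k.+1%:R]natr1 mulrDl mul1r.
have X0 : X 0%N = x by rewrite /X /s mul0r subr0 scale1r scale0r addr0.
have Xm : X m.+1 = y by rewrite /X /s divff ?pnatr_eq0// subrr scale0r scale1r add0r.
have XS k : `|X k - X k.+1| = `|x - y| / m.+1%:R.
  have -> : X k - X k.+1 = m.+1%:R^-1 *: (x - y).
    rewrite /X sS; move: (s k) (m.+1%:R^-1) => a b.
    rewrite opprD addrACA -!scalerBl scalerBr -scaleNr.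
    by congr (_ *: _ + _ *: _); ring.
  by rewrite normrZ normfV ger0_norm// mulrC.
suff H k : (k <= m.+1)%N -> `|phi x - phi (X k)| <= d%:R * (s k * `|x - y|).
  by have := H m.+1 (leqnn _); rewrite Xm /s divff ?pnatr_eq0// mul1r.
elim: k => [_|k ih km]; first by rewrite X0 subrr normr0 !mulr_ge0// invr_ge0.
rewrite -(subrKA (phi (X k))) (le_trans (ler_normD _ _))//.
rewrite sS mulrDl mulrDr lerD ?ih ?(ltnW km)// [_ * `|x - y|]mulrC -(XS k).
apply: (cube_lipschitz (c := X k) (rho := rho)) => //.
- move=> z; apply: (tube (1 - s k)).
    have /andP[sk0 sk1] := s01 k (ltnW km).
    by rewrite subr_ge0 sk1 gerBl.
  by rewrite subKr.
- by rewrite subrr normr0.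
- by rewrite distrC XS.
Qed.

(** Boundary points are reached by contracting [Omega] towards an interior point [c]: contracted
    points have cubes around them inside [Omega], contraction does not increase distances, and
    continuity of [phi] lets t tend to 0. *)
Lemma weak_lip1_lipschitz (phi : 'rV[R]_d -> V) (x y : 'rV[R]_d) :
  weak_lip1 Omega phi -> Omega x -> Omega y ->
  `|phi x - phi y| <= d%:R * `|x - y|.
Proof.
move=> lphi Ox Oy; have [cphi _] := lphi.
have [c /nbhs_ballP[rho /= rho0 cO]] := interiorOmega.
have Oc : Omega c by apply: cO; exact: ballxx.
pose X t (z : 'rV[R]_d) := (1 - t) *: z + t *: c.
(* [z'] is a convex combination of [z] and a point of the ball around [c]. *)
have Xcube t z : 0 < t <= 1 -> Omega z ->
    forall z', `|z' - X t z| < t * rho -> Omega z'.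
  move=> /andP[t0 t1] Oz z' z'X.
  have -> : z' = (1 - t) *: z + (1 - (1 - t)) *: (c + t^-1 *: (z' - X t z)).
    by rewrite subKr scalerDr scalerA mulfV ?gt_eqF// scale1r addrA subrKC.
  apply: convex_comb => //; last by rewrite subr_ge0 t1 gerBl ltW.
  apply: cO; rewrite mx_norm_ball /ball_/= opprD addNKr normrN normrZ.
  by rewrite gtr0_norm ?invr_gt0// ltr_pdivrMl.
apply/ler_addgt0Pr => e e0.
have e2 : 0 < e / 2 by rewrite divr_gt0.
have [r1 r1_gt0 H1] := within_continuousE cphi Ox e2.
have [r2 r2_gt0 H2] := within_continuousE cphi Oy e2.
have Xz t z : X t z - z = t *: (c - z).
  rewrite -[RHS](addrK z) /X scalerBl scale1r scalerBr; congr (_ - _).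
  by rewrite -addrA [- _ + _]addrC addrC.
(* M dominates both distances to [c] and 1, so a bound on [t * M] controls both displacements and
   also gives t <= 1. *)
pose M := 1 + `|c - x| + `|c - y|.
have M1 : 1 <= M by rewrite /M -addrA lerDl addr_ge0.
have M0 : 0 < M by rewrite (lt_le_trans _ M1).
pose t := Num.min 1 (Num.min r1 r2) / (2 * M).
have t0 : 0 < t by rewrite divr_gt0 ?mulr_gt0// !lt_min ltr01 r1_gt0.
have tle a : 0 < a -> Num.min 1 (Num.min r1 r2) <= a -> t * M < a.
  move=> a0 ma; rewrite /t invfM mulrA divfK ?gt_eqF// ltr_pdivrMr//.
  by rewrite (le_lt_trans ma)// ltr_pMr// ltr1n.
have tM1 : t * M < 1 by apply: tle => //; rewrite ge_min lexx.
have t1 : t <= 1 by rewrite ltW// (le_lt_trans _ tM1)// ler_peMr// ltW.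
have OX z : Omega z -> Omega (X t z).
  move=> Oz; apply: (Xcube t z) => //; first by rewrite t0 t1.
  by rewrite subrr normr0 mulr_gt0.
have Hx : `|phi (X t x) - phi x| <= e / 2.
  apply: H1; first exact: OX.
  rewrite Xz normrZ gtr0_norm// (le_lt_trans (y := t * M)) ?tle//.
    by rewrite ler_wpM2l ?(ltW t0)// /M; have := normr_ge0 (c - y); lra.
  by rewrite !ge_min lexx orbT.
have Hy : `|phi (X t y) - phi y| <= e / 2.
  apply: H2; first exact: OX.
  rewrite Xz normrZ gtr0_norm// (le_lt_trans (y := t * M)) ?tle//.
    by rewrite ler_wpM2l ?(ltW t0)// /M; have := normr_ge0 (c - x); lra.
  by rewrite !ge_min lexx !orbT.
have HX : `|phi (X t x) - phi (X t y)| <= d%:R * `|x - y|.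
  apply: le_trans (interior_lipschitz lphi (rho := t * rho) _ _ _) _.
  - by rewrite mulr_gt0.
  - by apply: Xcube => //; rewrite t0.
  - by apply: Xcube => //; rewrite t0.
  rewrite ler_wpM2l// /X opprD addrACA subrr addr0 -scalerBr normrZ.
  by rewrite ger0_norm ?subr_ge0// ler_piMl// gerBl ltW.
have -> : phi x - phi y = (phi (X t x) - phi (X t y)) +
    ((phi x - phi (X t x)) + (phi (X t y) - phi y)).
  by rewrite addrCA !subrKA.
rewrite (le_trans (ler_normD _ _))// lerD// (splitr e) (le_trans (ler_normD _ _))//.
by rewrite lerD// distrC.
Qed.

End lipschitz.

(** * Pairing with vector measures *)

Section charge_integration.
Context {R : realType} {d : nat} {Omega : set 'rV[R]_d}.
Hypothesis compactOmega : compact Omega.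
Local Notation T := (borel R d).
Implicit Types (m : {charge set T -> \bar R}) (P N : {measure set T -> \bar R}).
Implicit Types f g : 'rV[R]_d -> R.

Definition cint m f : R := fine (charge_integral m Omega f).

Definition mint P f : R := (\int[P]_(x in (Omega : set T)) f x)%R.

Lemma finite_integrable P f : (P setT < +oo)%E -> {within Omega, continuous f} ->
  P.-integrable (Omega : set T) (EFin \o f).
Proof.
move=> Pfin cf; apply: (@compact_integrable R d Omega compactOmega _ T P idfun) => //.
  exact: measurable_id.
apply: le_lt_trans Pfin; apply: le_measure; rewrite ?inE//.
exact: measurable_compact.
Qed.

Lemma integral_mintE P f : (P setT < +oo)%E -> {within Omega, continuous f} ->
  (\int[P]_(x in (Omega : set T)) (f x)%:E)%E = (mint P f)%:E.
Proof.
move=> Pfin cf; rewrite /mint /Rintegral fineK//.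
apply: (@integrable_fin_num _ _ _ P (Omega : set T)).
  exact: measurable_compact.
exact: finite_integrable.
Qed.

Lemma mint_add P N f : (P setT < +oo)%E -> (N setT < +oo)%E ->
  {within Omega, continuous f} -> mint (measure_add P N) f = mint P f + mint N f.
Proof.
move=> Pfin Nfin cf; apply: EFin_inj.
have PNfin : (measure_add P N setT < +oo)%E by rewrite measure_addE lte_add_pinfty.
rewrite EFinD -!integral_mintE// integral_measure_add//.
- exact: measurable_compact.
- exact: finite_integrable.
- exact: finite_integrable.
Qed.

Lemma eq_mint P N f : (forall A, measurable A -> P A = N A) -> mint P f = mint N f.
Proof.
move=> PN; rewrite /mint /Rintegral; congr fine.
by apply: eq_measure_integral => A mA _; exact: PN.
Qed.

Lemma mint_comb P f g (a b : R) : (P setT < +oo)%E ->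
  {within Omega, continuous f} -> {within Omega, continuous g} ->
  mint P (fun x => a * f x + b * g x) = a * mint P f + b * mint P g.
Proof.
move=> Pfin cf cg.
have mO := measurable_compact compactOmega.
have cM (c : R) h : {within Omega, continuous h} ->
    {within Omega, continuous (fun x => c * h x)}.
  by move=> ch; apply: (@within_continuousZ R _ _ R^o) => //; exact: within_continuous_cst.
rewrite /mint RintegralD//; [|exact: finite_integrable (cM _ _ _)..].
by rewrite !RintegralZl//; exact: finite_integrable.
Qed.

Lemma mint_bound P f (M : R) : (P setT < +oo)%E -> {within Omega, continuous f} ->
  (forall x, Omega x -> `|f x| <= M) -> `|mint P f| <= fine (P setT) * `|M|.
Proof.
move=> Pfin cf fM.
have mO := measurable_compact compactOmega.
apply: le_trans (le_normr_Rintegral _ (finite_integrable Pfin cf)) _ => //.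
have c1 : {within Omega, continuous (fun=> `|M| : R)}.
  exact: (@within_continuous_cst R _ _ R^o).
have cn : {within Omega, continuous (fun x => `|f x|)}.
  by apply: (within_continuous_comp _ cf); exact: norm_continuous.
apply: (@le_trans _ _ (mint P (fun=> `|M|))).
  apply: le_Rintegral => //; [exact: finite_integrable..|].
  by move=> x Ox; rewrite (le_trans (fM _ Ox))// ler_norm.
rewrite /mint Rintegral_cst// mulrC ler_wpM2r//.
have PO : (P Omega <= P setT)%E by apply: le_measure; rewrite ?inE.
by rewrite fine_le// ge0_fin_numE//; exact: le_lt_trans PO Pfin.
Qed.

(** [charge_integral] rests on a Hahn decomposition picked by choice; from here on only a splitting
    into two finite measures is remembered. *)
Lemma cint_jordan m : exists P N, [/\ (P setT < +oo)%E, (N setT < +oo)%E,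
  forall A, measurable A -> m A = (P A - N A)%E &
  forall f, {within Omega, continuous f} ->
    charge_integral m Omega f = (mint P f - mint N f)%:E].
Proof.
rewrite /charge_integral.
set H := projT2 (cid (projT2 (cid (Hahn_decomposition m)))).
have Pfin : (jordan_pos H setT < +oo)%E by rewrite -ge0_fin_numE// fin_num_measure.
have Nfin : (jordan_neg H setT < +oo)%E by rewrite -ge0_fin_numE// fin_num_measure.
exists (jordan_pos H), (jordan_neg H); split => //.
  by move=> A mA; rewrite (jordan_decomp H mA)/= /cadd/= cscaleN1.
by move=> f cf; rewrite EFinB -!integral_mintE.
Qed.

Lemma cintE m f : {within Omega, continuous f} ->
  charge_integral m Omega f = (cint m f)%:E.
Proof.
by move=> cf; have [P [N [_ _ _ E]]] := cint_jordan m; rewrite /cint E.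
Qed.

(** If P' - N' = P - N, then P' + N and P + N' are the same measure, so the integral does not depend
    on the splitting. Additivity in the measure needs this, since a sum of Jordan decompositions
    need not be one. *)
Lemma cint_decomp m P N f : (P setT < +oo)%E -> (N setT < +oo)%E ->
  (forall A, measurable A -> m A = (P A - N A)%E) ->
  {within Omega, continuous f} -> cint m f = mint P f - mint N f.
Proof.
move=> Pfin Nfin mPN cf; have [P' [N' [P'fin N'fin mPN' E]]] := cint_jordan m.
rewrite /cint E//=.
have : mint (measure_add P' N) f = mint (measure_add P N') f.
  apply: eq_mint => A mA.
  rewrite -[LHS]/(measure_add P' N A) -[RHS]/(measure_add P N' A) !measure_addE.
  have fin (Q : {measure set T -> \bar R}) : (Q setT < +oo)%E -> Q A \is a fin_num.
    move=> Qfin; rewrite ge0_fin_numE//; apply: le_lt_trans Qfin.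
    by apply: le_measure; rewrite ?inE.
  have := mPN A mA; rewrite mPN'//.
  rewrite -(fineK (fin P Pfin)) -(fineK (fin N Nfin)).
  rewrite -(fineK (fin P' P'fin)) -(fineK (fin N' N'fin)).
  by rewrite -!EFinB -!EFinD => -[e]; congr (_%:E); lra.
by rewrite !mint_add//; lra.
Qed.

Lemma cint_comb m f g (a b : R) :
  {within Omega, continuous f} -> {within Omega, continuous g} ->
  cint m (fun x => a * f x + b * g x) = a * cint m f + b * cint m g.
Proof.
move=> cf cg.
have cc : {within Omega, continuous (fun x => a * f x + b * g x)}.
  by apply: (@within_continuousD R _ _ R^o); apply: (@within_continuousZ R _ _ R^o) => //;
    exact: within_continuous_cst.
have [P [N [Pfin Nfin _ E]]] := cint_jordan m.
by rewrite /cint !E//= !mint_comb//; ring.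
Qed.

Lemma cint_bound m : exists2 C, 0 <= C & forall f M,
  {within Omega, continuous f} -> 0 <= M -> (forall x, Omega x -> `|f x| <= M) ->
  `|cint m f| <= C * M.
Proof.
have [P [N [Pfin Nfin _ E]]] := cint_jordan m.
exists (fine (P setT) + fine (N setT)).
  by rewrite addr_ge0// fine_ge0.
move=> f M cf M0 fM; rewrite /cint E//= mulrDl (le_trans (ler_normB _ _))//.
by rewrite lerD// -[in leRHS](ger0_norm M0); exact: mint_bound.
Qed.

Lemma cint_add m m1 m2 f : (forall A, measurable A -> m A = (m1 A + m2 A)%E) ->
  {within Omega, continuous f} -> cint m f = cint m1 f + cint m2 f.
Proof.
move=> mE cf.
have [P1 [N1 [P1fin N1fin m1E _]]] := cint_jordan m1.
have [P2 [N2 [P2fin N2fin m2E _]]] := cint_jordan m2.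
have add_fin (P N : {measure set T -> \bar R}) : (P setT < +oo)%E -> (N setT < +oo)%E ->
    (measure_add P N setT < +oo)%E.
  by move=> ? ?; rewrite measure_addE lte_add_pinfty.
rewrite (cint_decomp (add_fin _ _ P1fin P2fin) (add_fin _ _ N1fin N2fin))//.
  rewrite (cint_decomp P1fin N1fin m1E cf) (cint_decomp P2fin N2fin m2E cf).
  by rewrite !mint_add//; ring.
move=> A mA; rewrite -[RHS]/(measure_add P1 P2 A - measure_add N1 N2 A)%E.
rewrite mE// m1E// m2E// !measure_addE.
have fin (Q : {measure set T -> \bar R}) : (Q setT < +oo)%E -> Q A \is a fin_num.
  move=> Qfin; rewrite ge0_fin_numE//; apply: le_lt_trans Qfin.
  by apply: le_measure; rewrite ?inE.
rewrite -(fineK (fin _ P1fin)) -(fineK (fin _ N1fin)).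
rewrite -(fineK (fin _ P2fin)) -(fineK (fin _ N2fin)).
by rewrite -!EFinD; congr (_%:E); ring.
Qed.

Lemma mint_mscale_dirac (k : {nonneg R}) (x : T) f : Omega x ->
  {within Omega, continuous f} ->
  mint (mscale k (\d_x : {measure set T -> \bar R})) f = k%:num * f x.
Proof.
move=> Ox cf; have mO := measurable_compact compactOmega.
have mf : measurable_fun (Omega : set T) (EFin \o f).
  by apply/measurable_EFinP; exact: within_continuous_measurable.
rewrite /mint /Rintegral integralE.
rewrite !ge0_integral_mscale//; [|exact: measurable_funeneg|exact: measurable_funepos].
rewrite !integral_dirac//; [|exact: measurable_funeneg|exact: measurable_funepos].
rewrite diracE mem_set// !mul1e funeposE funenegE -EFinN -!EFin_max.
rewrite -!EFinM -EFinB/= -mulrBr; congr (_ * _).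
have [f0|f0] := leP 0 (f x); first by rewrite max_r ?oppr_le0// subr0.
by rewrite max_l ?sub0r ?opprK// oppr_ge0 ltW.
Qed.

Lemma cint_dirac m (c : R) (x : T) f : Omega x ->
  (forall A, measurable A -> m A = (c%:E * \d_x A)%E) ->
  {within Omega, continuous f} -> cint m f = c * f x.
Proof.
move=> Ox mE cf.
have p0 : 0 <= Num.max c 0 by rewrite le_max lexx orbT.
have n0 : 0 <= Num.max (- c) 0 by rewrite le_max lexx orbT.
have fin k : (mscale k (\d_x : {measure set T -> \bar R}) setT < +oo)%E.
  by rewrite /mscale/= diracE in_setT mule1 ltry.
have cE : c = Num.max c 0 - Num.max (- c) 0.
  have [c0|c0] := leP 0 c.
    by rewrite max_r ?oppr_le0// subr0.
  by rewrite max_l ?sub0r ?opprK// oppr_ge0 ltW.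
rewrite (cint_decomp (fin (NngNum p0)) (fin (NngNum n0)))//.
  by rewrite !mint_mscale_dirac//= -mulrBl -cE.
move=> A mA; rewrite mE// /mscale/= diracE.
by rewrite -!EFinM -EFinB -mulrBl -cE.
Qed.

End charge_integration.

(** * Compactness *)

Section compactness.
Context {R : realType} {d n : nat} {V : euclidean R n} {Omega : set 'rV[R]_d}.
Hypothesis compactOmega : compact Omega.
Hypothesis convexOmega :
  convex_set (Omega : set (convex_lmodType 'rV[R]_d)).
Hypothesis interiorOmega : Omega° !=set0.

Lemma finite_net e : 0 < e -> exists s : seq 'rV[R]_d,
  (forall x, x \in s -> Omega x) /\
  forall x, Omega x -> exists2 y, y \in s & `|x - y| < e.
Proof.
move=> e0; have := compactOmega; rewrite compact_cover.
move=> /(_ 'rV[R]_d Omega (fun y => ball y e)) [||s sO Os].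
- by move=> y _; exact: ball_open.
- by move=> x Ox; exists x => //; exact: ballxx.
- exists (finmap.enum_fset s); split=> [x xs|x /Os[y /= ys]].
    by have := sO x xs; rewrite inE.
  by rewrite mx_norm_ball /ball_/= distrC => yx; exists y.
Qed.

(** Tychonoff on the product over all points and coordinates gives a cluster point, not a
    subsequence; closeness on a finite set at arbitrarily late indices is all that is used. *)
Lemma pointwise_cluster (phi : nat -> 'rV[R]_d -> V) M :
  (forall k x, Omega x -> `|phi k x| <= M) ->
  exists phi' : 'rV[R]_d -> V, forall e K (s : seq 'rV[R]_d), 0 < e ->
    (forall x, x \in s -> Omega x) ->
    exists2 k, (K <= k)%N & forall x, x \in s -> `|phi k x - phi' x| <= e.
Proof.
move=> phiM.
pose I := ('rV[R]_d * 'I_n)%type.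
pose W := prod_topology (fun _ : I => R).
(* The bound holds only on [Omega], so the values elsewhere are replaced by 0. *)
pose F k : W := fun xi => if xi.1 \in Omega then inner V (phi k xi.1) (onb V xi.2) else 0.
have FM k xi : `|F k xi| <= `|M|.
  rewrite /F; case: ifPn; last by rewrite normr0.
  rewrite inE => /(phiM k) phikM; rewrite (le_trans (norm_inner_le _ _))//.
  by rewrite norm_onb mulr1 (le_trans phikM)// ler_norm.
have cB : compact [set f : W | forall xi, `[- `|M|, `|M|]%classic (f xi)].
  by apply: (@tychonoff I (fun=> R) (fun=> `[- `|M|, `|M|]%classic)) => xi;
    exact: segment_compact.
have [a [_ acl]] : [set f : W | forall xi, `[- `|M|, `|M|]%classic (f xi)] `&`
    cluster (F @ \oo) !=set0.
  apply: cB; exists 0%N => // k _ xi.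
  by rewrite /= in_itv/= -ler_norml.
exists (fun x => \sum_i a (x, i) *: onb V i) => e K s e0 sO.
(* The error is shared among [n] coordinates; [n.+1] covers n = 0. *)
pose e' := e / n.+1%:R.
have e'0 : 0 < e' by rewrite divr_gt0.
have near_a : nbhs a [set f : W | forall x, x \in s -> forall i, `|f (x, i) - a (x, i)| < e'].
  have FF : Filter (nbhs a) by exact: nbhs_filter.
  have one xi : nbhs a [set f : W | `|f xi - a xi| < e'].
    have c := @proj_continuous I (fun=> R) xi a.
    have na : nbhs a ((fun f : W => f xi) @^-1` ball (a xi : R) e').
      exact: (c _ (nbhsx_ballx (a xi : R) e' e'0)).
    have sub : (fun f : W => f xi) @^-1` ball (a xi : R) e' `<=`
        [set f : W | `|f xi - a xi| < e'].
      move=> f; rewrite /preimage /mkset -ball_normE /ball_ /mkset distrC; exact: id.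
    exact: (@filterS _ _ FF _ _ sub na).
  elim: s {sO} => [|x s ih]; first by
    apply: (@filterS _ _ FF setT); [move=> f _ x|exact: (@filterT _ _ FF)].
  have all_i : nbhs a [set f : W | forall i, `|f (x, i) - a (x, i)| < e'].
    pose P (i : 'I_n) (f : W) := `|f (x, i) - a (x, i)| < e'.
    exact: (@filter_forall _ _ P _ FF (fun i => one (x, i))).
  apply: (@filterS2 _ _ FF _ _ _ _ ih all_i) => f fs fx y; rewrite inE => /orP[/eqP ->//|].
  exact: fs.
have tailK : (F @ \oo) [set f | exists2 k, (K <= k)%N & f = F k].
  by exists K => // k /= Kk; exists k.
have [_ [[k Kk ->] Fka]] := acl _ _ tailK near_a.
exists k => // x xs.
rewrite [phi k x](onb_coord) -sumrB (le_trans (ler_norm_sum _ _ _))//.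
apply: (@le_trans _ _ (\sum_(i < n) e')).
  apply: ler_sum => i _; rewrite -scalerBl normrZ norm_onb mulr1.
  by have := Fka x xs i; rewrite /F/= mem_set; [exact: ltW|exact: sO].
rewrite sumr_const card_ord -mulr_natr /e' -mulrA ler_piMr ?(ltW e0)//.
by rewrite mulrC ler_pdivrMr// mul1r ler_nat.
Qed.

Lemma lipschitz_within_continuous (phi : 'rV[R]_d -> V) C :
  (forall x y, Omega x -> Omega y -> `|phi x - phi y| <= C * `|x - y|) ->
  {within Omega, continuous phi}.
Proof.
move=> lphi; apply/subspace_continuousP => x Ox.
apply/cvgrPdist_le => e e0; rewrite near_withinE.
have C1 : 0 < `|C| + 1 by rewrite ltr_wpDl.
apply/nbhs_ballP; exists (e / (`|C| + 1)) => /=; first exact: divr_gt0.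
move=> y; rewrite mx_norm_ball /ball_/= => xy Oy.
rewrite (le_trans (lphi x y Ox Oy))//.
rewrite ltr_pdivlMr// in xy; rewrite (le_trans _ (ltW xy))// mulrC ler_wpM2l//.
by rewrite (le_trans (ler_norm _))// lerDl.
Qed.

(* Arzela-Ascoli: the functions are equi-Lipschitz, so that pointwise
   accumulation points are uniform ones. *)
Lemma weak_lip1_compact (phi : nat -> 'rV[R]_d -> V) M :
  (forall k, weak_lip1 Omega (phi k)) ->
  (forall k x, Omega x -> `|phi k x| <= M) ->
  exists phi', [/\ weak_lip1 Omega phi',
    forall x, Omega x -> `|phi' x| <= M &
    forall e K, 0 < e -> exists2 k, (K <= k)%N &
      forall x, Omega x -> `|phi k x - phi' x| <= e].
Proof.
move=> lphi phiM; have [phi' phi'P] := pointwise_cluster phiM.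
have lip' x y : Omega x -> Omega y -> `|phi' x - phi' y| <= d%:R * `|x - y|.
  move=> Ox Oy; apply/ler_addgt0Pr => e e0.
  have e2 : 0 < e / 2 by rewrite divr_gt0.
  have [|k _ H] := phi'P _ 0%N [:: x; y] e2.
    by move=> z; rewrite !inE => /orP[] /eqP ->.
  have Hx : `|phi k x - phi' x| <= e / 2 by apply: H; rewrite !inE eqxx.
  have Hy : `|phi k y - phi' y| <= e / 2 by apply: H; rewrite !inE eqxx orbT.
  have Hk := weak_lip1_lipschitz compactOmega convexOmega interiorOmega (lphi k) Ox Oy.
  have -> : phi' x - phi' y = (phi k x - phi k y) +
      ((phi' x - phi k x) + (phi k y - phi' y)).
    by rewrite addrCA !subrKA.
  rewrite (le_trans (ler_normD _ _))// lerD// (splitr e) (le_trans (ler_normD _ _))//.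
  by rewrite lerD// distrC.
have unif e K : 0 < e -> exists2 k, (K <= k)%N &
    forall x, Omega x -> `|phi k x - phi' x| <= e.
  move=> e0; have e2 : 0 < e / 2 by rewrite divr_gt0.
  (* With mesh e/(4d + 1) each of the two Lipschitz terms costs at most e/4 and the net point e/2;
     the added 1 covers d = 0. *)
  have d0 : 0 < d%:R * 4 + 1 :> R by rewrite ltr_wpDl// mulr_ge0.
  have [s [sO sP]] := finite_net (divr_gt0 e0 d0).
  have [k Kk H] := phi'P _ K s e2 sO; exists k => // x Ox.
  have [y ys xy] := sP x Ox; have Oy := sO y ys.
  have H1 := weak_lip1_lipschitz compactOmega convexOmega interiorOmega (lphi k) Ox Oy.
  have H2 := lip' _ _ Oy Ox; rewrite distrC in xy.
  have H3 : d%:R * `|y - x| <= e / 4.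
    have : (d%:R * 4 + 1) * `|y - x| <= e by rewrite mulrC -ler_pdivlMr// ltW.
    by have := normr_ge0 (y - x); rewrite mulrDl mul1r mulrAC; move: (_ * `|y - x|) => N; lra.
  have -> : phi k x - phi' x = (phi k y - phi' y) +
      ((phi k x - phi k y) + (phi' y - phi' x)).
    by rewrite addrCA !subrKA.
  rewrite (le_trans (ler_normD _ _))// (splitr e) lerD ?H//.
  rewrite (le_trans (ler_normD _ _))//.
  by rewrite (distrC x y) in H1; lra.
have bound x : Omega x -> `|phi' x| <= M.
  move=> Ox; apply/ler_addgt0Pr => e e0.
  have [k _ H] := unif _ 0%N e0.
  rewrite -(subrK (phi k x) (phi' x)) (le_trans (ler_normD _ _))//.
  by rewrite addrC lerD ?phiM// distrC H.
exists phi'; split => //.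
apply: weak_lip1_closed => //; first exact: lipschitz_within_continuous lip'.
move=> e e0; have [k _ H] := unif _ 0%N e0.
by exists (phi k) => // x Ox; rewrite distrC H.
Qed.

End compactness.

(** * Vector measures, Dirac masses and total variation *)

Section vector_measures.
Context {R : realType} {d n : nat} {V : euclidean R n} {Omega : set 'rV[R]_d}.
Hypothesis compactOmega : compact Omega.
Implicit Types (phi : 'rV[R]_d -> V) (mu nu delta : vmeasure V Omega).

Definition vpair phi mu : R :=
  \sum_i cint (Omega := Omega) (vm_coord mu i) (fun x => inner V (phi x) (onb V i)).

Let ccoord phi i : {within Omega, continuous phi} ->
  {within Omega, continuous (fun x => inner V (phi x) (onb V i))}.
Proof.
by move=> cphi; exact: (within_continuous_comp (@inner_continuousl _ _ V (onb V i))).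
Qed.

Lemma vm_pairingE phi mu : {within Omega, continuous phi} ->
  vm_pairing phi mu = (vpair phi mu)%:E.
Proof.
move=> cphi; rewrite /vm_pairing /vpair -sumEFin; apply: eq_bigr => i _.
by rewrite cintE//; exact: ccoord.
Qed.

Lemma vpair_comb phi phi' mu (a b : R) :
  {within Omega, continuous phi} -> {within Omega, continuous phi'} ->
  vpair (fun x => a *: phi x + b *: phi' x) mu = a * vpair phi mu + b * vpair phi' mu.
Proof.
move=> cphi cphi'; rewrite /vpair !mulr_sumr -big_split/=; apply: eq_bigr => i _.
under [X in cint _ X]eq_fun do rewrite innerDl !innerZl.
by rewrite (cint_comb compactOmega)//; exact: ccoord.
Qed.

Lemma vpairZ phi mu (a : R) : {within Omega, continuous phi} ->
  vpair (fun x => a *: phi x) mu = a * vpair phi mu.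
Proof.
move=> cphi; have := vpair_comb mu a 0 cphi cphi.
by under [X in vpair X _]eq_fun do rewrite scale0r addr0; rewrite mul0r addr0.
Qed.

Lemma vpair_bound mu : exists2 C, 0 <= C & forall phi M,
  {within Omega, continuous phi} -> 0 <= M -> (forall x, Omega x -> `|phi x| <= M) ->
  `|vpair phi mu| <= C * M.
Proof.
have /choice[C HC] i : exists C, 0 <= C /\ forall f M,
    {within Omega, continuous f} -> 0 <= M -> (forall x, Omega x -> `|f x| <= M) ->
    `|cint (Omega := Omega) (vm_coord mu i) f| <= C * M.
  by have [C C0 H] := cint_bound compactOmega (vm_coord mu i); exists C.
exists (\sum_i C i); first by apply: sumr_ge0 => i _; case: (HC i).
move=> phi M cphi M0 phiM; rewrite mulr_suml (le_trans (ler_norm_sum _ _ _))//.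
apply: ler_sum => i _; have [_ H] := HC i; apply: H => //; first exact: ccoord.
move=> x Ox; rewrite (le_trans (norm_inner_le _ _))// norm_onb mulr1.
exact: phiM.
Qed.

Lemma vpair_add phi mu nu : {within Omega, continuous phi} ->
  vpair phi (vm_add mu nu) = vpair phi mu + vpair phi nu.
Proof.
move=> cphi; rewrite /vpair -big_split/=; apply: eq_bigr => i _.
apply: (cint_add compactOmega); last exact: ccoord.
by move=> A mA; rewrite -[LHS]/((inner V (mu A + nu A) (onb V i))%:E) innerDl.
Qed.

Lemma vpair_sub phi mu nu : {within Omega, continuous phi} ->
  vpair phi (vm_sub mu nu) = vpair phi mu - vpair phi nu.
Proof.
move=> cphi; apply/eqP; rewrite eq_sym subr_eq eq_sym; apply/eqP.
rewrite /vpair -big_split/=; apply: eq_bigr => i _; apply/esym.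
apply: (cint_add compactOmega); last exact: ccoord.
move=> A mA; rewrite -[RHS]/((inner V (mu A - nu A) (onb V i))%:E +
  (inner V (nu A) (onb V i))%:E)%E.
by rewrite -EFinD -innerDl subrK.
Qed.

Section vdirac.
Variables (x : 'rV[R]_d) (v : V).
Hypothesis Ox : Omega x.

Let vdirac_fun (A : set (borel R d)) : V := \1_A x *: v.

Let vdirac_sigma_additive (F : (set (borel R d))^nat) :
  (forall k, measurable (F k)) -> trivIset setT F ->
  (fun m => \sum_(0 <= k < m) vdirac_fun (F k)) @ \oo --> vdirac_fun (\bigcup_k F k).
Proof.
move=> mF tF; under eq_fun do rewrite -scaler_suml; apply: cvgZr_tmp.
have H : EFin (\sum_(0 <= k < m) \1_(F k) x : R) @[m --> \oo] -->
    (\1_(\bigcup_k F k) x : R)%:E.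
  rewrite (_ : (fun m => _) = (fun m =>
      (\sum_(0 <= k < m) (\d_(x : borel R d) (F k) : \bar R))%E)).
    by apply: measure_semi_sigma_additive => //; exact: bigcup_measurable.
  by apply/funext => m; rewrite -sumEFin.
exact: (fine_cvg H).
Qed.

Let vdirac_concentrated (A : set (borel R d)) :
  measurable A -> A `&` Omega = set0 -> vdirac_fun A = 0.
Proof.
move=> mA AO; rewrite /vdirac_fun indicE memNset ?scale0r// => Ax.
by have : (A `&` Omega) x by []; rewrite AO.
Qed.

Definition vdirac : vmeasure V Omega :=
  VMeasure vdirac_sigma_additive vdirac_concentrated.

Lemma vpair_dirac phi : {within Omega, continuous phi} ->
  vpair phi vdirac = inner V (phi x) v.
Proof.
move=> cphi; rewrite inner_coord; apply: eq_bigr => i _.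
rewrite (@cint_dirac _ _ _ compactOmega _ (inner V v (onb V i)) x)//.
- by rewrite mulrC.
- move=> A mA; rewrite -[LHS]/((inner V (\1_A x *: v) (onb V i))%:E) innerZl.
  by rewrite /dirac -EFinM mulrC.
- exact: ccoord.
Qed.

End vdirac.

Lemma discrete_vmeasure (mu : vmeasure V Omega) (s : seq 'rV[R]_d) (w : 'rV[R]_d -> V) :
  (forall x, x \in s -> Omega x) -> exists delta : vmeasure V Omega,
  forall phi, {within Omega, continuous phi} ->
    vpair phi delta = \sum_(x <- s) inner V (phi x) (w x).
Proof.
elim: s => [_|x s ih sO].
  (* The zero measure, obtained as [mu - mu]. *)
  by exists (vm_sub mu mu) => phi cphi; rewrite vpair_sub// subrr big_nil.
have [|delta H] := ih; first by move=> y ys; apply: sO; rewrite inE ys orbT.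
have Ox : Omega x by apply: sO; rewrite inE eqxx.
exists (vm_add (vdirac (w x) Ox) delta) => phi cphi.
by rewrite vpair_add// vpair_dirac// H// big_cons.
Qed.

Lemma sup_norm_le phi M :
  (sup_norm Omega phi <= M%:E)%E <-> (forall x, Omega x -> `|phi x| <= M).
Proof.
split => [H x Ox|H].
  by rewrite -lee_fin; apply: le_trans H; apply: ereal_sup_ubound; exists x.
by apply: ge_ereal_sup => _ [x Ox <-]; rewrite lee_fin H.
Qed.

Lemma le_vm_norm phi delta c : 0 < c ->
  {within Omega, continuous phi} -> (forall x, Omega x -> `|phi x| <= c) ->
  ((vpair phi delta)%:E <= c%:E * vm_norm delta)%E.
Proof.
move=> c0 cphi phic.
have cphi' : {within Omega, continuous (fun x => c^-1 *: phi x)}.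
  by apply: within_continuousZ => //; exact: (@within_continuous_cst R _ _ R^o).
have -> : vpair phi delta = c * vpair (fun x => c^-1 *: phi x) delta.
  by rewrite vpairZ// mulrA mulfV ?mul1r// gt_eqF.
rewrite EFinM lee_pmul2l//; apply: ereal_sup_ubound.
exists (fun x => c^-1 *: phi x); last by rewrite vm_pairingE.
split => //; apply/sup_norm_le => x Ox.
by rewrite normrZ gtr0_norm ?invr_gt0// ler_pdivrMl// mulr1 phic.
Qed.

End vector_measures.

(** * Duality by penalization *)

Section truncation.
Context {R : realType} {n : nat} {V : euclidean R n} (lambda : R).
Hypothesis lambda_gt0 : 0 < lambda.
Implicit Types u v : V.

(* [excess v] is [v] minus its projection on the ball of radius [lambda]. *)
Definition excess v : V :=
  if `|v| <= lambda then 0 else (1 - lambda / `|v|) *: v.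

Lemma excess_norm v : `|excess v| = Num.max (`|v| - lambda) 0.
Proof.
rewrite /excess; case: (leP `|v| lambda) => [vl|lv].
  by rewrite normr0 max_r// subr_le0.
have v0 : 0 < `|v| by apply: lt_trans lv.
have p0 : 0 < 1 - lambda / `|v| by rewrite subr_gt0 ltr_pdivrMr// mul1r.
rewrite normrZ gtr0_norm// max_l ?subr_ge0 ?ltW//.
by rewrite mulrBl mul1r divfK// gt_eqF.
Qed.

Lemma trunc_norm v : `|v - excess v| <= lambda.
Proof.
rewrite /excess; case: (leP `|v| lambda) => [vl|lv]; first by rewrite subr0.
have v0 : 0 < `|v| by apply: lt_trans lv.
rewrite scalerBl scale1r subKr normrZ ger0_norm ?divr_ge0 ?(ltW lambda_gt0)//.
by rewrite divfK// gt_eqF.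
Qed.

(** As soon as the excess is nonzero, the projection has norm lambda and the direction of
    [excess v]. This equality case of Cauchy-Schwarz later produces the term lambda |delta|. *)
Lemma inner_excess_trunc v : inner V (excess v) (v - excess v) = lambda * `|excess v|.
Proof.
rewrite excess_norm /excess; case: (leP `|v| lambda) => [vl|lv].
  by rewrite inner0l max_r ?mulr0// subr_le0.
have v0 : 0 < `|v| by apply: lt_trans lv.
have -> : v - (1 - lambda / `|v|) *: v = (lambda / `|v|) *: v.
  by rewrite scalerBl scale1r subKr.
rewrite innerZl innerZr inner_sqr.
rewrite max_l ?subr_ge0 ?ltW//; field.
by rewrite gt_eqF.
Qed.

(** The norm of the excess is the distance to the ball, so any point of the ball bounds it from
    above. *)
Lemma excess_le v u : `|u| <= lambda -> `|excess v| <= `|v - u|.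
Proof.
move=> ul; rewrite excess_norm ge_max normr_ge0 andbT.
have := ler_normD (v - u) u; rewrite subrK; lra.
Qed.

Lemma excess_lip u v : `|excess u| <= `|excess v| + `|u - v|.
Proof.
apply: le_trans (excess_le u (trunc_norm v)) _.
have -> : u - (v - excess v) = excess v + (u - v) by rewrite opprB addrCA.
exact: ler_normD.
Qed.

Lemma excess_le_norm v : `|excess v| <= `|v|.
Proof. by rewrite -{2}[v]subr0; apply: excess_le; rewrite normr0 ltW. Qed.

Lemma excess0 : excess 0 = 0.
Proof. by rewrite /excess normr0 ltW. Qed.

End truncation.

(** * The penalized problem and its first-order condition *)

Section penalization.
Context {R : realType} {d n : nat} {V : euclidean R n}.
Variable Omega : set 'rV[R]_d.
Hypothesis compactOmega : compact Omega.
Hypothesis convexOmega :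
  convex_set (Omega : set (convex_lmodType 'rV[R]_d)).
Hypothesis interiorOmega : Omega° !=set0.
Variables (lambda : R) (sigma : vmeasure V Omega).
Hypothesis lambda_gt0 : 0 < lambda.
Implicit Types (phi psi : 'rV[R]_d -> V).

Definition bounded_weak_lip1 M phi :=
  weak_lip1 Omega phi /\ forall x, Omega x -> `|phi x| <= M.

Definition penalized (c : R) (s : seq 'rV[R]_d) phi : R :=
  vpair phi sigma - c * \sum_(x <- s) `|excess lambda (phi x)| ^+ 2.

Lemma penalized_uniform c s M : 0 <= c -> 0 <= M ->
  (forall x, x \in s -> Omega x) ->
  exists2 C, 0 <= C & forall phi psi e, 0 <= e ->
    bounded_weak_lip1 M phi -> bounded_weak_lip1 M psi ->
    (forall x, Omega x -> `|phi x - psi x| <= e) ->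
    penalized c s phi <= penalized c s psi + C * e.
Proof.
move=> c0 M0 sO; have [C C0 HC] := vpair_bound compactOmega sigma.
(* M + M bounds the sum of two excesses a and b in b^2 - a^2 = (b - a)(b + a). *)
exists (C + c * \sum_(x <- s) (M + M)).
  by rewrite addr_ge0// mulr_ge0// sumr_ge0// => x _; rewrite addr_ge0.
move=> phi psi e e0 [[cphi _] phiM] [[cpsi _] psiM] close.
rewrite /penalized mulrDl addrACA lerD//.
  rewrite -lerBlDl.
  have -> : vpair phi sigma - vpair psi sigma =
      vpair (fun x => 1 *: phi x + (- 1) *: psi x) sigma.
    by rewrite (vpair_comb compactOmega)// mul1r mulN1r.
  rewrite (le_trans (ler_norm _))// HC//.
    by apply: within_continuousD; apply: within_continuousZ => //;
      exact: (@within_continuous_cst R _ _ R^o).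
  by move=> x Ox; rewrite scale1r scaleN1r close.
suff H : \sum_(x <- s) `|excess lambda (psi x)| ^+ 2 <=
    \sum_(x <- s) `|excess lambda (phi x)| ^+ 2 + (\sum_(x <- s) (M + M)) * e.
  by have := ler_wpM2l c0 H; rewrite mulrDr mulrA; lra.
rewrite mulr_suml -big_split/= big_seq [leRHS]big_seq; apply: ler_sum => x /sO Ox.
have p1 : `|excess lambda (phi x)| <= M.
  exact: le_trans (excess_le_norm lambda_gt0 _) (phiM _ Ox).
have p2 : `|excess lambda (psi x)| <= M.
  exact: le_trans (excess_le_norm lambda_gt0 _) (psiM _ Ox).
have l1 := excess_lip lambda_gt0 (psi x) (phi x).
rewrite distrC in l1; have l2 := close _ Ox.
have a0 := normr_ge0 (excess lambda (phi x)).
have b0 := normr_ge0 (excess lambda (psi x)).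
set a := `|excess lambda (phi x)| in p1 l1 a0 *.
set b := `|excess lambda (psi x)| in p2 l1 b0 *.
have : (b - a) * (b + a) <= e * (M + M).
  apply: (@le_trans _ _ (e * (b + a))).
    by rewrite ler_wpM2r ?addr_ge0//; lra.
  by rewrite ler_wpM2l//; lra.
by rewrite -subr_sqr; lra.
Qed.

(** Direct method on a maximizing sequence with gaps 1/(k + 1). The net is arbitrary, so that the
    empty one yields the maximizer of the dual problem itself. *)
Lemma max_exists c s M : 0 <= c -> 0 <= M -> (forall x, x \in s -> Omega x) ->
  exists2 phi, bounded_weak_lip1 M phi &
    forall psi, bounded_weak_lip1 M psi -> penalized c s psi <= penalized c s phi.
Proof.
move=> c0 M0 sO; have [C C0 HC] := penalized_uniform c0 M0 sO.
have K0 : bounded_weak_lip1 M (fun=> 0).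
  by split; [exact: weak_lip1_0|move=> x _; rewrite normr0].
pose S := [set penalized c s phi | phi in bounded_weak_lip1 M].
have S0 : S !=set0 by exists (penalized c s (fun=> 0)), (fun=> 0).
have Sub : has_ubound S.
  exists (penalized c s (fun=> 0) + C * M) => _ [phi Kphi <-].
  by apply: HC => // x Ox; rewrite subr0; exact: Kphi.2.
have /choice[phi phiP] k : exists phi, bounded_weak_lip1 M phi /\
    sup S - k.+1%:R^-1 < penalized c s phi.
  have [|_ [phi Kphi <-] lt] := sup_adherent (eps := k.+1%:R^-1) _ (conj S0 Sub).
    by rewrite invr_gt0.
  by exists phi.
have [|k x Ox|phi' [lphi' phi'M unif]] :=
    weak_lip1_compact compactOmega convexOmega interiorOmega (phi := phi) (M := M).
- by move=> k; case: (phiP k) => -[].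
- by case: (phiP k) => -[_ H] _; exact: H.
exists phi' => // psi Kpsi.
apply: (@le_trans _ _ (sup S)); first by apply: ub_le_sup => //; exists psi.
apply/ler_addgt0Pr => e e0.
have e2 : 0 < e / 2 by rewrite divr_gt0.
(* Closeness to the limit is available only at some late indices, so [K] is fixed first and k >= K
   keeps the gap below e/2. *)
have [K] := ltr_add_invr e2; rewrite add0r => Ke.
have C1 : 0 < C + 1 by rewrite ltr_wpDl.
have [k Kk H] := unif (e / 2 / (C + 1)) K (divr_gt0 e2 C1).
have [Kphik supk] := phiP k.
have := HC (phi k) phi' _ (ltW (divr_gt0 e2 C1)) Kphik (conj lphi' phi'M) H.
have : C * (e / 2 / (C + 1)) <= e / 2.
  by rewrite mulrCA ler_piMr ?(ltW e2)// ler_pdivrMr// mul1r lerDl.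
have : k.+1%:R^-1 <= K.+1%:R^-1 :> R.
  by rewrite lef_pV2 ?posrE// ler_nat.
move: Ke supk; move: (k.+1%:R^-1) (K.+1%:R^-1) (C * _) => a b c' H1 H2 H3 H4 H5.
lra.
Qed.

Lemma comb_bound M M' Mpsi phi psi t : 0 <= t <= 1 ->
  bounded_weak_lip1 M' phi -> weak_lip1 Omega psi ->
  (forall x, Omega x -> `|psi x| <= Mpsi) -> 0 <= M' -> M' + t * Mpsi <= M ->
  bounded_weak_lip1 M (fun x => (1 - t) *: phi x + t *: psi x).
Proof.
move=> /andP[t0 t1] [lphi phiM] lpsi psiM M'0 tM; split.
  by apply: weak_lip1_comb => //; rewrite ?subr_ge0// subrK.
move=> x Ox; apply: le_trans (ler_normD _ _) _; apply: le_trans tM.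
rewrite !normrZ (ger0_norm t0) ger0_norm ?subr_ge0// lerD//.
  by rewrite -[leRHS]mul1r ler_pM ?subr_ge0// ?gerBl// phiM.
by rewrite ler_wpM2l// psiM.
Qed.

(* First-order optimality: the derivative of the penalty is a sum of Dirac
   masses, which is the measure [delta] of the dual problem. *)
Lemma penalized_optimality c s M M' phi psi : 0 <= c -> 0 <= M' -> M' < M ->
  (forall x, x \in s -> Omega x) ->
  bounded_weak_lip1 M' phi ->
  (forall psi, bounded_weak_lip1 M psi -> penalized c s psi <= penalized c s phi) ->
  weak_lip1 Omega psi ->
  vpair psi sigma - vpair phi sigma <=
  \sum_(x <- s) inner V (psi x - phi x) ((2 * c) *: excess lambda (phi x)).
Proof.
move=> c0 M'0 M'M sO Kphi phimax lpsi.
have [cpsi _] := lpsi; have [[cphi _] _] := Kphi.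
have [Mpsi Mpsi0 psiM] := compact_within_bounded compactOmega cpsi.
pose B := c * \sum_(x <- s) `|psi x - phi x| ^+ 2.
have B0 : 0 <= B by rewrite mulr_ge0// sumr_ge0// => x _; exact: exprn_ge0.
have B1 : 0 < B + 1 by rewrite ltr_wpDl.
set I := \sum_(x <- s) _.
(* The margin M - M' keeps the convex combination admissible for small t, whatever the size of
   [psi]. *)
have key t : 0 < t <= 1 -> t * Mpsi <= M - M' ->
    vpair psi sigma - vpair phi sigma <= I + t * B.
  move=> /andP[t0 t1] tM.
  have /phimax : bounded_weak_lip1 M (fun x => (1 - t) *: phi x + t *: psi x).
    apply: (comb_bound (M' := M') (Mpsi := Mpsi)) => //; first by rewrite ltW.
    by rewrite -lerBrDl.
  rewrite /penalized (vpair_comb compactOmega)// => le1.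
  have le2 : \sum_(x <- s) `|excess lambda ((1 - t) *: phi x + t *: psi x)| ^+ 2 <=
      \sum_(x <- s) (`|excess lambda (phi x)| ^+ 2 +
        (t * 2 * inner V (psi x - phi x) (excess lambda (phi x)) +
         t ^+ 2 * `|psi x - phi x| ^+ 2)).
    apply: ler_sum => x _.
    (* The projection of phi(x) is kept fixed as comparison point of the ball while phi(x) moves;
       expanding the squared distance to it leaves the linear term and a remainder of order t^2. *)
    have le3 := excess_le lambda_gt0 ((1 - t) *: phi x + t *: psi x)
      (trunc_norm lambda_gt0 (phi x)).
    have le4 : `|excess lambda ((1 - t) *: phi x + t *: psi x)| ^+ 2 <=
        `|excess lambda (phi x) + t *: (psi x - phi x)| ^+ 2.
      rewrite lerXn2r ?nnegrE//; apply: le_trans le3 _.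
      suff -> : (1 - t) *: phi x + t *: psi x - (phi x - excess lambda (phi x)) =
          excess lambda (phi x) + t *: (psi x - phi x) by [].
      rewrite scalerBl scale1r opprB scalerBr addrCA; congr (_ + _).
      by rewrite addrAC [phi x - _ - _]addrAC subrr add0r addrC.
    apply: le_trans le4 _.
    rewrite -!inner_sqr innerDl !innerDr !innerZl !innerZr.
    rewrite (innerC (excess _ _)); lra.
  have := ler_wpM2l c0 le2; rewrite !big_split/= -!mulr_sumr => le5.
  have IE : I = 2 * c * \sum_(x <- s) inner V (psi x - phi x) (excess lambda (phi x)).
    by rewrite mulr_sumr; apply: eq_bigr => x _; rewrite innerZr.
  rewrite -(ler_pM2l t0) IE /B.
  by rewrite expr2 in le5; lra.
apply/ler_addgt0Pr => e e0.
pose t := Num.min 1 (Num.min ((M - M') / Mpsi) (e / (B + 1))).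
have t0 : 0 < t by rewrite !lt_min ltr01 !divr_gt0// subr_gt0.
have t1 : t <= 1 by rewrite ge_min lexx.
apply: le_trans (key t _ _) _.
- by rewrite t0.
- by rewrite -ler_pdivlMr// !ge_min lexx orbT.
rewrite lerD2l; apply: (@le_trans _ _ (e / (B + 1) * B)).
  by rewrite ler_wpM2r// !ge_min lexx !orbT.
by rewrite mulrAC ler_pdivrMr// ler_wpM2l ?ltW// ltrDl.
Qed.

End penalization.

(** * Weak and strong duality *)

Section duality.
Context {R : realType} {d n : nat} {V : euclidean R n} {Omega : set 'rV[R]_d}.
Hypothesis compactOmega : compact Omega.
Hypothesis convexOmega :
  convex_set (Omega : set (convex_lmodType 'rV[R]_d)).
Hypothesis interiorOmega : Omega° !=set0.
Variables (lambda : R) (mu nu : vmeasure V Omega).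
Hypothesis lambda_gt0 : 0 < lambda.
Let sigma := vm_sub nu mu.
Implicit Types phi psi : 'rV[R]_d -> V.

(** Comparison with the zero function bounds the penalty by C (lambda + 1), so this [c] forces an
    excess of at most tau/2 at each net point. The Lipschitz constant [d] is independent of [c], so
    a net of mesh tau/(2d + 1) costs only another tau/2 elsewhere. *)
Lemma penalized_small tau : 0 < tau < 1 -> exists c s (phi : 'rV[R]_d -> V),
  [/\ 0 <= c, forall x, x \in s -> Omega x,
      bounded_weak_lip1 Omega (lambda + tau) phi &
      forall psi, bounded_weak_lip1 Omega (lambda + 1) psi ->
        penalized lambda sigma c s psi <= penalized lambda sigma c s phi].
Proof.
move=> /andP[tau0 tau1].
have [C C0 HC] := vpair_bound compactOmega sigma.
have tau2 : 0 < (tau / 2) ^+ 2 by rewrite exprn_gt0// divr_gt0.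
have M0 : 0 <= lambda + 1 by rewrite addr_ge0// ltW.
pose c := (C * (lambda + 1) + 1) / (tau / 2) ^+ 2.
have num0 : 0 < C * (lambda + 1) + 1 by rewrite ltr_wpDl// mulr_ge0.
have c0 : 0 < c by exact: divr_gt0.
have d0 : 0 < d%:R * 2 + 1 :> R by rewrite ltr_wpDl// mulr_ge0.
have [s [sO sP]] := finite_net compactOmega (divr_gt0 tau0 d0).
have [phi [lphi phiM] phimax] := max_exists compactOmega convexOmega interiorOmega
  sigma lambda_gt0 (ltW c0) M0 sO.
exists c, s, phi; split => //; first exact: ltW.
split => //.
have near_net y : y \in s -> `|phi y| <= lambda + tau / 2.
  move=> ys.
  have /phimax : bounded_weak_lip1 Omega (lambda + 1) (fun=> 0 : V).
    by split; [exact: weak_lip1_0|move=> x _; rewrite normr0].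
  have c0V : {within Omega, continuous (fun=> 0 : V)} by exact: within_continuous_cst.
  have v0 : vpair (fun=> 0 : V) sigma = 0.
    have := vpairZ compactOmega sigma 0 c0V; rewrite mul0r => <-.
    by congr vpair; apply/funext => x; rewrite scale0r.
  rewrite /penalized v0 excess0// normr0 expr0n/= big1// mulr0 subr0 => pen0.
  have [cphi _] := lphi.
  have S1 := HC phi _ cphi M0 phiM.
  have S2 := le_trans (ler_norm _) S1.
  have one : `|excess lambda (phi y)| ^+ 2 <= \sum_(x <- s) `|excess lambda (phi x)| ^+ 2.
    rewrite (big_rem y)//= lerDl sumr_ge0// => x _; exact: exprn_ge0.
  have : c * `|excess lambda (phi y)| ^+ 2 <= c * (tau / 2) ^+ 2.
    rewrite {2}/c divfK ?gt_eqF//.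
    have := ler_wpM2l (ltW c0) one; lra.
  rewrite ler_pM2l// => le2.
  have : `|excess lambda (phi y)| <= tau / 2.
    by rewrite -(@ler_pXn2r _ 2) ?nnegrE ?divr_ge0// ltW.
  rewrite excess_norm// ge_max => /andP[? _]; lra.
move=> x Ox; have [y ys xy] := sP x Ox.
have := weak_lip1_lipschitz compactOmega convexOmega interiorOmega lphi Ox (sO y ys).
have := near_net y ys.
have : (d%:R * 2 + 1) * `|x - y| <= tau by rewrite mulrC -ler_pdivlMr// ltW.
have := ler_normD (phi x - phi y) (phi y); rewrite subrK.
rewrite mulrDl mul1r mulrAC; move: (normr_ge0 (x - y)).
by move: (_ * `|x - y|) => N; lra.
Qed.

(** The first-order condition makes [phi] maximize <psi, sigma - delta> among all [psi] with
    gradient bound 1, which bounds [W1]. It remains to compare <phi, delta> with lambda |delta|. *)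
Lemma dual_upper tau : 0 < tau < 1 ->
  exists2 phi, bounded_weak_lip1 Omega (lambda + tau) phi &
    (T11 lambda mu nu <= (vpair phi sigma)%:E)%E.
Proof.
move=> tau01; have [c [s [phi [c0 sO Kphi phimax]]]] := penalized_small tau01.
exists phi => //; have [[cphi _] _] := Kphi.
have /andP[tau0 tau1] := tau01.
pose w x := (2 * c) *: excess lambda (phi x).
have [delta deltaP] := discrete_vmeasure compactOmega mu w sO.
have normw : (vm_norm delta <= (\sum_(x <- s) `|w x|)%:E)%E.
  apply: ge_ereal_sup => _ [psi [cpsi /sup_norm_le psi1] <-].
  rewrite vm_pairingE// lee_fin deltaP// big_seq [leRHS]big_seq.
  apply: ler_sum => x /sO Ox; rewrite (le_trans (inner_le_norm _ _))//.
  by rewrite -[leRHS]mul1r ler_wpM2r// psi1.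
have W1le : (W1 (vm_add mu delta) nu <= (vpair phi sigma - vpair phi delta)%:E)%E.
  apply: ge_ereal_sup => _ [psi [cpsi gpsi] <-].
  rewrite vm_pairingE// lee_fin.
  have -> : vpair psi (vm_sub nu (vm_add mu delta)) = vpair psi sigma - vpair psi delta.
    by rewrite /sigma !vpair_sub// vpair_add//; ring.
  have lt' : lambda + tau < lambda + 1 by rewrite ltrD2l.
  have := penalized_optimality compactOmega lambda_gt0 c0 _ lt' sO Kphi phimax
    (conj cpsi gpsi).
  move=> /(_ (addr_ge0 (ltW lambda_gt0) (ltW tau0))).
  under eq_bigr do rewrite innerBl.
  by rewrite sumrB -!deltaP//; lra.
apply: (@le_trans _ _ (W1 (vm_add mu delta) nu + lambda%:E * vm_norm delta)%E).
  by apply: ereal_inf_lbound; exists delta.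
apply: le_trans (leeD W1le (lee_wpmul2l _ normw)) _; first by rewrite lee_fin ltW.
rewrite -EFinM -EFinD lee_fin.
(* Since phi is excess plus projection, <phi, w> = 2c (lambda |excess| + |excess|^2) >= lambda
   |w|. *)
suff : lambda * \sum_(x <- s) `|w x| <= vpair phi delta by lra.
rewrite deltaP// mulr_sumr; apply: ler_sum => x _.
rewrite /w normrZ ger0_norm ?mulr_ge0// mulrCA -inner_excess_trunc// -innerZl innerC.
rewrite !innerZr ler_wpM2l ?mulr_ge0// innerBl lerBlDl lerDr inner_sqr.
exact: exprn_ge0.
Qed.

(** Split <phi, sigma> into <phi, sigma - delta> + <phi, delta>: [phi] competes in [W1], and |phi|
    <= lambda bounds the second term by lambda |delta|. *)
Lemma weak_duality phi : bounded_weak_lip1 Omega lambda phi ->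
  ((vpair phi sigma)%:E <= T11 lambda mu nu)%E.
Proof.
move=> [[cphi gphi] phil]; apply: le_ereal_inf_tmp => _ [delta _ <-].
have -> : vpair phi sigma = vpair phi (vm_sub nu (vm_add mu delta)) + vpair phi delta.
  by rewrite /sigma !vpair_sub// vpair_add//; ring.
rewrite EFinD leeD//; last exact: le_vm_norm.
by rewrite -vm_pairingE//; apply: ereal_sup_ubound; exists phi.
Qed.

Lemma dual_admissibleE phi :
  dual_admissible Omega lambda phi <-> bounded_weak_lip1 Omega lambda phi.
Proof.
by split => [[cphi gphi /sup_norm_le phil]|[[cphi gphi] /sup_norm_le phil]].
Qed.

Lemma dual_max : exists2 phi : 'rV[R]_d -> V, bounded_weak_lip1 Omega lambda phi &
  forall psi, bounded_weak_lip1 Omega lambda psi -> vpair psi sigma <= vpair phi sigma.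
Proof.
(* Over the empty net the penalty vanishes. *)
have [//|phi Kphi phimax] := max_exists compactOmega convexOmega interiorOmega sigma
  lambda_gt0 (lexx 0) (ltW lambda_gt0) (s := [::]).
exists phi => // psi Kpsi.
by have := phimax _ Kpsi; rewrite /penalized !big_nil !mulr0 !subr0.
Qed.

Lemma strong_duality phi : bounded_weak_lip1 Omega lambda phi ->
  (forall psi, bounded_weak_lip1 Omega lambda psi -> vpair psi sigma <= vpair phi sigma) ->
  T11 lambda mu nu = (vpair phi sigma)%:E.
Proof.
move=> Kphi phimax; apply/eqP; rewrite eq_le weak_duality// andbT.
set D := vpair phi sigma.
(* The zero function is admissible. *)
have D0 : 0 <= D.
  have [[cphi _] _] := Kphi.
  have <- : vpair (fun x => (0 : R) *: phi x) sigma = 0.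
    by rewrite (vpairZ compactOmega)// mul0r.
  apply: phimax; split; first by apply: weak_lip1_scale Kphi.1; rewrite // lexx ler01.
  by move=> x _; rewrite scale0r normr0 ltW.
apply/lee_addgt0Pr => e e0.
have D1 : 0 < D + 1 by rewrite ltr_wpDl.
(* Rescaling will give <psi, sigma> <= (1 + tau/lambda) D, and this choice makes tau D / lambda at
   most e. *)
pose tau := Num.min (1 / 2) (e * lambda / (D + 1)).
have tau0 : 0 < tau by rewrite lt_min !divr_gt0// mulr_gt0.
have tau1 : tau < 1 by rewrite (le_lt_trans (y := 1 / 2)) ?ge_min ?lexx//; lra.
have [psi [lpsi psiM] Tle] := dual_upper (tau := tau) ltac:(by rewrite tau0 tau1).
apply: le_trans Tle _; rewrite -EFinD lee_fin.
have lt0 : 0 < lambda + tau by exact: addr_gt0.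
pose a := lambda / (lambda + tau).
have a0 : 0 < a by exact: divr_gt0.
have [cpsi _] := lpsi.
have := phimax (fun x => a *: psi x).
rewrite (vpairZ compactOmega)//.
have Ka : bounded_weak_lip1 Omega lambda (fun x => a *: psi x).
  split.
    apply: weak_lip1_scale lpsi => //.
    by rewrite (ltW a0)/= /a ler_pdivrMr// mul1r lerDl ltW.
  move=> x Ox; rewrite normrZ gtr0_norm// /a mulrAC ler_pdivrMr// ler_wpM2l ?psiM//.
  exact: ltW.
move=> /(_ Ka); rewrite -/D /a mulrAC ler_pdivrMr// => le1.
rewrite -(ler_pM2l lambda_gt0); apply: le_trans le1 _.
have : tau * (D + 1) <= e * lambda by rewrite -ler_pdivlMr// ge_min lexx orbT.
have : 0 <= tau by exact: ltW.
rewrite !mulrDr mulr1 (mulrC D lambda) (mulrC D tau) lerD2l (mulrC lambda e).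
lra.
Qed.

End duality.

Theorem theorem3p5 (R : realType) (d n : nat) (V : euclidean R n)
    (Omega : set 'rV[R]_d) (lambda : R) (mu nu : vmeasure V Omega)
    (compactOmega : compact Omega)
    (convexOmega : convex_set (Omega : set (convex_lmodType 'rV[R]_d)))
    (interiorOmega : Omega° !=set0)
    (lambda_gt0 : 0 < lambda) :
  (exists2 phi : 'rV[R]_d -> V, dual_admissible Omega lambda phi &
     vm_pairing phi (vm_sub nu mu) = dual_value lambda mu nu) /\
  T11 lambda mu nu = dual_value lambda mu nu.
Proof.
have [phi Kphi phimax] :=
  dual_max compactOmega convexOmega interiorOmega mu nu lambda_gt0.
have [[cphi _] _] := Kphi.
have dualE : dual_value lambda mu nu = (vpair phi (vm_sub nu mu))%:E.
  apply/eqP; rewrite eq_le; apply/andP; split.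
    apply: ge_ereal_sup => _ [psi /dual_admissibleE Kpsi <-].
    by rewrite vm_pairingE ?lee_fin ?phimax//; case: Kpsi => -[].
  by apply: ereal_sup_ubound; exists phi; [exact/dual_admissibleE|exact: vm_pairingE].
split; last by rewrite dualE; exact: strong_duality.
by exists phi; [exact/dual_admissibleE|rewrite dualE vm_pairingE].
Qed.
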